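(* Let $A,B\subset\mathbb R$ be bounded measurable sets of finite measure and let $c>0$. Put $K_{A,B,c}:=P_{cB}\mathcal FP_A$, $S_{A,B,c}:=K_{A,B,c}^*K_{A,B,c}$, and define $$m:=c|A||B|,\qquad \zeta:=\frac{\pi c}{2}\operatorname{diam}_{\mathrm{ess}}(A)\operatorname{diam}_{\mathrm{ess}}(B).$$ Then, for every $N\in\mathbb N_0$ (with the convention $\zeta^0=1$, including when $\zeta=0$), $$s_{N+1}(K_{A,B,c})\le\sqrt m\,\frac{\zeta^N}{N!}.$$ Consequently, for $0<\epsilon<1/2$, $$\Lambda_\epsilon(S_{A,B,c})\le\mathcal N_{\mathrm{fac}}(m,\zeta,\epsilon):=\min\left\{N\in\mathbb N_0:\ \sqrt m\,\frac{\zeta^N}{N!}\le\sqrt\epsilon\right\}.$$ In particular, $m\le\epsilon$ implies $\Lambda_\epsilon(S_{A,B,c})=0$. If $m>\epsilon$, set $\rho:=\frac12\log\frac m\epsilon>0$ and $h:=c\operatorname{diam}_{\mathrm{ess}}(A)\operatorname{diam}_{\mathrm{ess}}(B)$. Then $$\Lambda_\epsilon(S_{A,B,c})\le\left\lceil\frac{\rho}{W_0\!\left(\rho/(e\zeta)\right)}\right\rceil=\left\lceil\frac{\rho}{W_0\!\left(2\rho/(e\pi h)\right)}\right\rceil,$$ where $W_0$ is the principal real branch of the Lambert function. Moreover, when $m>\epsilon$, $\mathcal N_{\mathrm{fac}}(m,\zeta,\epsilon)$ is at most this Lambert expression.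
   Context: $P_E$ is multiplication by the indicator of $E$ on $L^2(\mathbb R)$; $(\mathcal Ff)(\xi)=\int_{\mathbb R}e^{-2\pi i x\xi}f(x)\,dx$ is the unitary Fourier transform. $s_1(K)\ge s_2(K)\ge\cdots$ are the singular values of a compact operator with multiplicity. For a positive contraction $S$, $\Lambda_\epsilon(S):=\operatorname{rank}\mathbf 1_{(\epsilon,1-\epsilon)}(S)$. For bounded measurable $E$, $\operatorname{diam}_{\mathrm{ess}}(E):=\operatorname{ess\,sup}_{x,y\in E}|x-y|$, with the convention that it is $0$ for a null set. *)

(* Defs.v *)
From mathcomp Require Import all_boot all_order all_algebra.
From mathcomp Require Import all_classical all_reals all_analysis.
From mathcomp Require Import ess_sup_inf complex.

Set Implicit Arguments.
Unset Strict Implicit.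
Unset Printing Implicit Defensive.

Import Order.TTheory GRing.Theory Num.Theory.
Import numFieldNormedType.Exports.

Local Open Scope classical_set_scope.
Local Open Scope ring_scope.
Local Open Scope complex_scope.

(* The space L^2(T, mu) of complex functions is represented by the functions
   satisfying [L2 mu], with [aeq mu] as equality.  An operator is a map on
   functions, of which only the action on [L2 mu] matters; equations between
   values of operators are read almost everywhere. *)
Section Hilbert.
Context d (T : measurableType d) (R : realType).
Variable mu : {measure set T -> \bar R}.

Definition L2 (f : T -> R[i]) : Prop :=
  [/\ measurable_fun [set: T] (fun x => complex.Re (f x)),
      measurable_fun [set: T] (fun x => complex.Im (f x)) &
      (\int[mu]_x ((complex.Re (f x)) ^+ 2 + (complex.Im (f x)) ^+ 2)%:E
        < +oo)%E].

Definition aeq (f g : T -> R[i]) : Prop := {ae mu, forall x, f x = g x}.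

Definition cintegral (f : T -> R[i]) : R[i] :=
  Rintegral mu [set: T] (fun x => complex.Re (f x)) +i*
  Rintegral mu [set: T] (fun x => complex.Im (f x)).

Definition inner (f g : T -> R[i]) : R[i] :=
  cintegral (fun x => f x * conjc (g x)).

Definition linear_op (P : (T -> R[i]) -> T -> R[i]) : Prop :=
  [/\ forall f, L2 f -> L2 (P f),
      forall f g, L2 f -> L2 g -> aeq f g -> aeq (P f) (P g) &
      forall (a : R[i]) f g, L2 f -> L2 g ->
        aeq (P (fun x => a * f x + g x)) (fun x => a * P f x + P g x)].

Definition is_adjoint (K L : (T -> R[i]) -> T -> R[i]) : Prop :=
  linear_op L /\
  forall f g, L2 f -> L2 g -> inner (K f) g = inner f (L g).

(* The adjoint of a bounded operator exists and is unique up to [aeq]. *)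
Definition adjoint (K : (T -> R[i]) -> T -> R[i]) : (T -> R[i]) -> T -> R[i] :=
  xget (fun _ _ => 0) [set L | is_adjoint K L].

Definition orthonormal n (u : 'I_n -> T -> R[i]) : Prop :=
  (forall i, L2 (u i)) /\ (forall i j, inner (u i) (u j) = (i == j)%:R).

(* For a compact operator K and n >= 1, the n-th singular value: the n-th
   largest square root of an eigenvalue of K^* K, each eigenvalue being repeated
   according to its multiplicity, or 0 when there are fewer than n nonzero ones.
   It is at least s > 0 iff there are n orthonormal eigenvectors of K^* K whose
   eigenvalues are squares of numbers >= s. *)
Definition singular_value (K : (T -> R[i]) -> T -> R[i]) (n : nat) : \bar R :=
  ereal_sup [set s%:E | s in [set s : R | s = 0 \/
    (0 < s /\ exists (u : 'I_n -> T -> R[i]) (sigma : 'I_n -> R),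
      orthonormal u /\ forall i, s <= sigma i /\
        aeq (adjoint K (K (u i))) (fun x => (sigma i ^+ 2)%:C * u i x))]].

Definition linearly_independent n (u : 'I_n -> T -> R[i]) : Prop :=
  forall a : 'I_n -> R[i],
    aeq (fun x => \sum_(i < n) a i * u i x) (fun=> 0) -> forall i, a i = 0.

(* Dimension of the range. *)
Definition rank (P : (T -> R[i]) -> T -> R[i]) : \bar R :=
  ereal_sup [set n%:R%:E | n in [set n : nat |
    exists u : 'I_n -> T -> R[i],
      (forall i, L2 (u i)) /\ linearly_independent (fun i => P (u i))]].

Definition orthogonal_projection (P : (T -> R[i]) -> T -> R[i]) : Prop :=
  [/\ linear_op P,
      forall f, L2 f -> aeq (P (P f)) (P f) &
      forall f g, L2 f -> L2 g -> inner (P f) g = inner f (P g)].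

(* [E] is a projection-valued measure on the Borel sets of the real line and
   S = \int lambda dE(lambda).  Countable additivity of [E] is carried by the
   existence, for every f, of the measure B |-> <E(B) f, f>; the integral
   formula is stated on the quadratic form of S, which determines S. *)
Definition is_spectral_measure (S : (T -> R[i]) -> T -> R[i])
    (E : set R -> (T -> R[i]) -> T -> R[i]) : Prop :=
  [/\ forall D : set (measurableTypeR R),
        measurable D -> orthogonal_projection (E D),
      forall f, L2 f -> aeq (E set0 f) (fun=> 0) /\ aeq (E setT f) f,
      forall (D D' : set (measurableTypeR R)) f,
        measurable D -> measurable D' -> L2 f ->
        aeq (E (D `&` D') f) (E D (E D' f)) &
      forall f, L2 f ->
        exists nu : {measure set (measurableTypeR R) -> \bar R},
          [/\ forall D : set (measurableTypeR R), measurable D ->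
                nu D = (complex.Re (inner (E D f) f))%:E,
              nu.-integrable setT (fun l : R => l%:E) &
              inner (S f) f = (Rintegral nu setT (fun l : R => l))%:C]].

(* By the spectral theorem a bounded self-adjoint S has a spectral measure,
   unique up to [aeq]; [spectral_proj S D] is the operator 1_D(S). *)
Definition spectral_proj (S : (T -> R[i]) -> T -> R[i]) :
    set R -> (T -> R[i]) -> T -> R[i] :=
  xget (fun _ _ _ => 0) [set E | is_spectral_measure S E].

Definition Lambda (eps : R) (S : (T -> R[i]) -> T -> R[i]) : \bar R :=
  rank (spectral_proj S `]eps, 1 - eps[%classic).

End Hilbert.

Section Fourier.
Variable R : realType.

(* The real line with its Lebesgue (not merely Borel) measurable sets. *)
Definition lebT := caratheodory_type (wlength (@idfun R))^*%mu.

Definition leb : {measure set lebT -> \bar R} := completed_lebesgue_measure.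

Definition lebesgue_measurable (E : set R) : Prop := measurable (E : set lebT).

Definition vol (E : set R) : R := fine (leb E).

(* The indicator makes the value 0 when E is a null set, and leaves the
   essential supremum over E x E unchanged otherwise. *)
Definition diam_ess (E : set R) : R :=
  fine (@ess_sup _ (lebT * lebT)%type R (leb \x leb)%E
    (fun p : R * R => (`|p.1 - p.2| * \1_(E `*` E) p)%:E)).

Definition expi (t : R) : R[i] := cos t +i* sin t.

Definition mul_indic (E : set R) (f : R -> R[i]) : R -> R[i] :=
  fun x => (\1_E x)%:C * f x.

(* On L^1 \cap L^2 this is the unitary Fourier transform.  Below it is applied
   only to functions of L^2 multiplied by the indicator of a bounded set. *)
Definition fourier (f : R -> R[i]) : R -> R[i] :=
  fun xi => cintegral leb (fun x : R => expi (- (2 * pi * x * xi)) * f x).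

Definition dilate (c : R) (E : set R) : set R := [set c * x | x in E].

Definition Kop (A B : set R) (c : R) (f : R -> R[i]) : R -> R[i] :=
  mul_indic (dilate c B) (fourier (mul_indic A f)).

Definition Sop (A B : set R) (c : R) (f : R -> R[i]) : R -> R[i] :=
  adjoint leb (Kop A B c) (Kop A B c f).

Definition N_fac (m zeta eps : R) : nat :=
  xget 0%N [set N : nat |
    Num.sqrt m * (zeta ^+ N / N`!%:R) <= Num.sqrt eps /\
    forall k : nat, Num.sqrt m * (zeta ^+ k / k`!%:R) <= Num.sqrt eps ->
      (N <= k)%N].

(* The principal real branch, on [-1/e, +oo). *)
Definition lambertW0 (x : R) : R :=
  xget 0 [set w : R | -1 <= w /\ w * expR w = x].

End Fourier.

(* Main.v *)
(* On a set of points x within a of x0, and frequencies xi within b of xi0, the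
   kernel exp(2 pi i x xi) is, up to factors of modulus 1 depending on one
   variable only, exp(2 pi i (x - x0)(xi - xi0)); truncating its Taylor series
   after N terms gives a kernel of rank N with error at most (2 pi a b)^N / N!.
   With the essential midpoints of A and cB this error is zeta^N / N!.  Hence
   there are N functions such that |K f| <= sqrt m zeta^N / N! |f| for every f
   orthogonal to them.  Any N + 1 independent functions have a nontrivial
   combination of this kind, which bounds the dimension of the spaces on which
   |K f|^2 = <S f, f> exceeds a given multiple of |f|^2, as in Courant-Fischer.
   The Lambert bound comes from N! >= (N / e)^N.

   [adjoint] and [spectral_proj] are choices with a default value; since only
   upper bounds are proved, the existence of adjoints and of spectral measures
   is not needed: the bounds hold for the default values too. *)

Require Import Defs.
From mathcomp Require Import all_boot all_order all_algebra.
From mathcomp Require Import all_classical all_reals all_analysis.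
From mathcomp Require Import measurable_realfun ess_sup_inf complex.
From mathcomp Require Import ring lra.
Set Implicit Arguments.
Unset Strict Implicit.
Unset Printing Implicit Defensive.

Import Order.TTheory GRing.Theory Num.Theory.
Import numFieldNormedType.Exports.

Local Open Scope classical_set_scope.
Local Open Scope ring_scope.
Local Open Scope complex_scope.

(** * Real and imaginary parts, and the squared modulus *)

Section ComplexParts.
Variable R : realType.
Implicit Types z w : R[i].
Local Notation re := complex.Re.
Local Notation im := complex.Im.

Lemma reM z w : re (z * w) = re z * re w - im z * im w.
Proof. by case: z w => [a b] [c d]. Qed.
Lemma imM z w : im (z * w) = re z * im w + im z * re w.
Proof. by case: z w => [a b] [c d]. Qed.
Lemma reD z w : re (z + w) = re z + re w.
Proof. by case: z w => [a b] [c d]. Qed.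
Lemma imD z w : im (z + w) = im z + im w.
Proof. by case: z w => [a b] [c d]. Qed.
Lemma reN z : re (- z) = - re z.
Proof. by case: z => [a b]. Qed.
Lemma imN z : im (- z) = - im z.
Proof. by case: z => [a b]. Qed.
Lemma re_conj z : re (conjc z) = re z.
Proof. by case: z => [a b]. Qed.
Lemma im_conj z : im (conjc z) = - im z.
Proof. by case: z => [a b]. Qed.

(** The squared modulus as an element of [R], ready for real integration; the norm of [R[i]] takes
    its values in [R[i]]. *)
Definition nsq z : R := re z ^+ 2 + im z ^+ 2.

Definition reimE := (reM, imM, reD, imD, reN, imN, re_conj, im_conj).

Lemma complex_ext z w : re z = re w -> im z = im w -> z = w.
Proof. by case: z w => [a b] [c d] /= -> ->. Qed.

Lemma nsq_ge0 z : 0 <= nsq z.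
Proof. by rewrite addr_ge0 ?sqr_ge0. Qed.

Lemma nsq_eq0 z : nsq z = 0 -> z = 0.
Proof.
move/eqP; rewrite paddr_eq0 ?sqr_ge0// !sqrf_eq0 => /andP[/eqP a /eqP b].
exact: complex_ext.
Qed.

Lemma nsqM z w : nsq (z * w) = nsq z * nsq w.
Proof. by rewrite /nsq !reimE; ring. Qed.

Lemma nsqC (a : R) : nsq a%:C = a ^+ 2.
Proof. by rewrite /nsq /= expr0n addr0. Qed.

Lemma nsq_conj z : nsq (conjc z) = nsq z.
Proof. by rewrite /nsq !reimE sqrrN. Qed.

Lemma nsqE z : z * conjc z = (nsq z)%:C.
Proof. by apply: complex_ext; rewrite /nsq !reimE/=; ring. Qed.

End ComplexParts.

(** * Square integrable functions, their inner product, and Cauchy-Schwarz *)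

Section L2Space.
Context d (T : measurableType d) (R : realType).
Variable mu : {measure set T -> \bar R}.
Local Notation re := complex.Re.
Local Notation im := complex.Im.
Local Notation L2 := (L2 mu).
Local Notation inner := (inner mu).
Local Notation aeq := (aeq mu).
Implicit Types f g h : T -> R[i].

Definition cmeas f := measurable_fun [set: T] (fun x => re (f x)) /\
  measurable_fun [set: T] (fun x => im (f x)).

Definition cintegrable f := mu.-integrable [set: T] (EFin \o (fun x => re (f x))) /\
  mu.-integrable [set: T] (EFin \o (fun x => im (f x))).

Definition normsq f : R := Rintegral mu [set: T] (fun x => nsq (f x)).

Lemma cmeas_cst (a : R[i]) : cmeas (fun=> a).
Proof. by split; exact: measurable_cst. Qed.

Lemma cmeasM f g : cmeas f -> cmeas g -> cmeas (fun x => f x * g x).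
Proof.
move=> [rf mf] [rg mg]; split.
- under eq_fun do rewrite reM.
  by apply: measurable_funB; apply: measurable_funM.
- under eq_fun do rewrite imM.
  by apply: measurable_funD; apply: measurable_funM.
Qed.

Lemma cmeasD f g : cmeas f -> cmeas g -> cmeas (fun x => f x + g x).
Proof.
move=> [rf mf] [rg mg]; split.
- under eq_fun do rewrite reD.
  exact: measurable_funD.
- under eq_fun do rewrite imD.
  exact: measurable_funD.
Qed.

Lemma cmeas_conj f : cmeas f -> cmeas (fun x => conjc (f x)).
Proof.
move=> [rf mf]; split; first by under eq_fun do rewrite re_conj.
under eq_fun do rewrite im_conj.
exact: measurableT_comp.
Qed.

Lemma measurable_nsq f : cmeas f -> measurable_fun [set: T] (fun x => nsq (f x)).
Proof. by move=> [rf mf]; apply: measurable_funD; exact: measurable_funX. Qed.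

Lemma L2P f : L2 f <->
  cmeas f /\ mu.-integrable [set: T] (EFin \o (fun x => nsq (f x))).
Proof.
split=> [[rf mf fi]|[cf /integrableP[_ fi]]].
  split=> //; apply/integrableP; split.
    by apply/measurable_EFinP; exact: measurable_nsq.
  apply: le_lt_trans fi; rewrite le_eqVlt; apply/orP; left; apply/eqP.
  by apply: eq_integral => x _ /=; rewrite ger0_norm// nsq_ge0.
have [rf mf] := cf; split=> //.
apply: le_lt_trans fi; rewrite le_eqVlt; apply/orP; left; apply/eqP.
by apply: eq_integral => x _ /=; rewrite ger0_norm// nsq_ge0.
Qed.

Lemma L2_meas f : L2 f -> cmeas f.
Proof. by move=> /L2P[]. Qed.

Lemma L2_int f : L2 f -> mu.-integrable [set: T] (EFin \o (fun x => nsq (f x))).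
Proof. by move=> /L2P[]. Qed.

Lemma L2_le f (g : T -> R) : cmeas f -> mu.-integrable [set: T] (EFin \o g) ->
  (forall x, nsq (f x) <= g x) -> L2 f.
Proof.
move=> mf gi fg; apply/L2P; split=> //.
apply: le_integrable gi => //.
  by apply/measurable_EFinP; exact: measurable_nsq.
move=> x _ /=; rewrite lee_fin ger0_norm ?nsq_ge0//.
exact: le_trans (fg x) (ler_norm _).
Qed.

Lemma Rintegral0T : Rintegral mu [set: T] (fun=> 0) = 0.
Proof. by rewrite /Rintegral integral0. Qed.

Lemma integrable_addr (g h : T -> R) : mu.-integrable [set: T] (EFin \o g) ->
  mu.-integrable [set: T] (EFin \o h) ->
  mu.-integrable [set: T] (EFin \o (fun x => g x + h x)).
Proof.
move=> gi hi.
by have := integrableD measurableT gi hi; apply: eq_integrable => // x _.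
Qed.

Lemma integrable_mulrl a (g : T -> R) : mu.-integrable [set: T] (EFin \o g) ->
  mu.-integrable [set: T] (EFin \o (fun x => a * g x)).
Proof.
move=> gi.
by have := integrableZl measurableT a gi; apply: eq_integrable => // x _.
Qed.

Lemma nsq_lin (a z w : R[i]) : nsq (a * z + w) <= 2 * (nsq a * nsq z) + 2 * nsq w.
Proof.
rewrite -nsqM; move: (a * z) => t; rewrite /nsq !reimE.
have := sqr_ge0 (re t - re w); have := sqr_ge0 (im t - im w); nra.
Qed.

Lemma L2_lin (a : R[i]) f g : L2 f -> L2 g -> L2 (fun x => a * f x + g x).
Proof.
move=> Lf Lg; have := (L2_meas Lf, L2_meas Lg) => -[mf mg].
apply: (@L2_le _ (fun x => 2 * (nsq a * nsq (f x)) + 2 * nsq (g x))).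
- by apply: cmeasD => //; apply: cmeasM => //; exact: cmeas_cst.
- apply: integrable_addr; last exact/integrable_mulrl/L2_int.
  exact/integrable_mulrl/integrable_mulrl/L2_int.
- by move=> x; exact: nsq_lin.
Qed.

Lemma L2_0 : L2 (fun=> 0).
Proof.
apply: (@L2_le _ (fun=> 0)); first exact: cmeas_cst.
- exact: integrable0.
- by move=> x; rewrite /nsq /= expr0n addr0.
Qed.

Lemma L2_sum n (a : 'I_n -> R[i]) (u : 'I_n -> T -> R[i]) :
  (forall i, L2 (u i)) -> L2 (fun x => \sum_(i < n) a i * u i x).
Proof.
elim: n a u => [|n IH] a u Lu.
  by under eq_fun do rewrite big_ord0; exact: L2_0.
under eq_fun do rewrite big_ord_recl.
by apply: L2_lin => //; exact: IH.
Qed.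

(** The squares of a - c, a + c, b - e and b + e are nonnegative. The right side is the integrable
    majorant that makes [inner] converge on [L2]. *)
Lemma re_mul_conj_le (z w : R[i]) : `|re (z * conjc w)| <= nsq z + nsq w.
Proof.
case: z w => [a b] [c e]; rewrite /nsq !reimE/=.
have := sqr_ge0 (a - c); have := sqr_ge0 (a + c).
have := sqr_ge0 (b - e); have := sqr_ge0 (b + e).
by rewrite ler_norml => ? ? ? ?; apply/andP; split; nra.
Qed.

Lemma im_mul_conj_le (z w : R[i]) : `|im (z * conjc w)| <= nsq z + nsq w.
Proof.
case: z w => [a b] [c e]; rewrite /nsq !reimE/=.
have := sqr_ge0 (a - e); have := sqr_ge0 (a + e).
have := sqr_ge0 (b - c); have := sqr_ge0 (b + c).
by rewrite ler_norml => ? ? ? ?; apply/andP; split; nra.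
Qed.

Lemma L2_mul_conj f g : L2 f -> L2 g -> cintegrable (fun x => f x * conjc (g x)).
Proof.
move=> Lf Lg.
have [mr mi] : cmeas (fun x => f x * conjc (g x)).
  by apply: cmeasM; [exact: L2_meas|exact/cmeas_conj/L2_meas].
have fgi := integrable_addr (L2_int Lf) (L2_int Lg).
split; apply: le_integrable fgi => //; try exact/measurable_EFinP.
- move=> x _ /=; rewrite lee_fin (le_trans (re_mul_conj_le _ _))//; exact: ler_norm.
- move=> x _ /=; rewrite lee_fin (le_trans (im_mul_conj_le _ _))//; exact: ler_norm.
Qed.

Lemma cintegral_lin (a : R[i]) f g : cintegrable f -> cintegrable g ->
  cintegral mu (fun x => a * f x + g x) = a * cintegral mu f + cintegral mu g.
Proof.
move=> [rf mf] [rg mg]; apply: complex_ext; rewrite !reimE /=.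
- have -> : (fun x => re (a * f x + g x)) =
      (fun x => re a * re (f x) + (- im a * im (f x) + re (g x))).
    by apply/funext => x; rewrite !reimE; ring.
  rewrite RintegralD//; last 2 first.
  + exact: integrable_mulrl.
  + by apply: integrable_addr => //; exact: integrable_mulrl.
  rewrite RintegralD//; last exact: integrable_mulrl.
  by rewrite !RintegralZl//; ring.
- have -> : (fun x => im (a * f x + g x)) =
      (fun x => re a * im (f x) + (im a * re (f x) + im (g x))).
    by apply/funext => x; rewrite !reimE; ring.
  rewrite RintegralD//; last 2 first.
  + exact: integrable_mulrl.
  + by apply: integrable_addr => //; exact: integrable_mulrl.
  rewrite RintegralD//; last exact: integrable_mulrl.
  by rewrite !RintegralZl//; ring.
Qed.

Lemma inner_lin (a : R[i]) f g h : L2 f -> L2 g -> L2 h ->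
  inner (fun x => a * f x + g x) h = a * inner f h + inner g h.
Proof.
move=> Lf Lg Lh; rewrite /inner -cintegral_lin; [|exact: L2_mul_conj..].
by congr cintegral; apply/funext => x; ring.
Qed.

Lemma innerC f g : L2 f -> L2 g -> inner g f = conjc (inner f g).
Proof.
move=> Lf Lg; have [ri ii] := L2_mul_conj Lf Lg.
apply: complex_ext; rewrite !reimE /=.
- by congr Rintegral; apply/funext => x; rewrite !reimE; ring.
- rewrite -mulN1r -RintegralZl//.
  by congr Rintegral; apply/funext => x; rewrite !reimE; ring.
Qed.

Lemma inner_aeql f g h : L2 f -> L2 g -> L2 h -> aeq f g -> inner f h = inner g h.
Proof.
move=> Lf Lg Lh fg; have [rf mf] := L2_mul_conj Lf Lh.
have [rg mg] := L2_mul_conj Lg Lh.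
by apply: complex_ext; rewrite /= /Rintegral; congr fine; apply: ae_eq_integral => //;
  try exact: (measurable_int mu); apply: filterS fg => x + _ => /= ->.
Qed.

Lemma aeq_sym f g : aeq f g -> aeq g f.
Proof. by apply: filterS => x ->. Qed.

Lemma aeq_trans f g h : aeq f g -> aeq g h -> aeq f h.
Proof. by move=> fg; apply: filterS2 fg => x -> ->. Qed.

Lemma inner_self f : inner f f = (normsq f)%:C.
Proof.
apply: complex_ext => /=; first by congr Rintegral; apply/funext => x; rewrite nsqE.
rewrite -Rintegral0T.
by congr Rintegral; apply/funext => x; rewrite nsqE.
Qed.

Lemma normsq_ge0 f : 0 <= normsq f.
Proof. by apply: Rintegral_ge0 => x _; exact: nsq_ge0. Qed.

Lemma normsqE f : L2 f -> (normsq f)%:E = (\int[mu]_x (nsq (f x))%:E)%E.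
Proof.
move=> /L2_int fi; rewrite /normsq /Rintegral fineK//.
exact: integrable_fin_num fi.
Qed.

Lemma normsq_eq0 f : L2 f -> normsq f = 0 -> aeq f (fun=> 0).
Proof.
move=> Lf f0; have := normsqE Lf; rewrite f0 => /esym i0.
have := (ae_eq_integral_abs mu measurableT (measurable_int mu (L2_int Lf))).1.
have -> : (\int[mu]_x `|(EFin \o (fun x => nsq (f x))) x|)%E = 0%E.
  by rewrite -[RHS]i0; apply: eq_integral => x _ /=; rewrite ger0_norm ?nsq_ge0.
move/(_ erefl); apply: filterS => x /(_ I) /= [/nsq_eq0].
by [].
Qed.

Lemma inner0l f : inner (fun=> 0) f = 0.
Proof.
by apply: complex_ext; rewrite /= -[RHS]Rintegral0T;
  congr Rintegral; apply/funext => x; rewrite !reimE !mul0r ?subr0 ?addr0.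
Qed.

Lemma inner_sum n (a : 'I_n -> R[i]) (u : 'I_n -> T -> R[i]) h :
  (forall i, L2 (u i)) -> L2 h ->
  inner (fun x => \sum_(i < n) a i * u i x) h = \sum_(i < n) a i * inner (u i) h.
Proof.
move=> + Lh; elim: n a u => [|n IH] a u Lu.
  by under eq_fun do rewrite big_ord0; rewrite big_ord0 inner0l.
under eq_fun do rewrite big_ord_recl.
by rewrite inner_lin// ?IH// ?big_ord_recl//; exact: L2_sum.
Qed.

Lemma normsq_lin (a : R[i]) f g : L2 f -> L2 g ->
  normsq (fun x => a * f x + g x) =
  nsq a * normsq f + normsq g + 2 * re (a * inner f g).
Proof.
move=> Lf Lg; have Lh := L2_lin a Lf Lg.
have := inner_self (fun x => a * f x + g x).
rewrite inner_lin// (innerC Lh Lf) (innerC Lh Lg) !inner_lin//.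
rewrite !inner_self (innerC Lf Lg) => /(congr1 (@complex.Re R)); rewrite [RHS]/= => <-.
move: (inner f g) (normsq f) (normsq g) => [p q] F G.
rewrite /nsq !reimE /=. ring.
Qed.

(** If |g| = 0 then g vanishes almost everywhere and both sides are 0. Otherwise f minus its
    projection on g has a nonnegative squared norm. *)
Lemma inner_CS f g : L2 f -> L2 g -> nsq (inner f g) <= normsq f * normsq g.
Proof.
move=> Lf Lg.
have [g0|gn0] := eqVneq (normsq g) 0.
  rewrite g0 mulr0 (innerC Lg Lf) nsq_conj.
  rewrite (inner_aeql Lg L2_0 Lf (normsq_eq0 Lg g0)) inner0l.
  by rewrite /nsq /= expr0n addr0.
have gp : 0 < normsq g by rewrite lt_neqAle eq_sym gn0 normsq_ge0.
(* The squared norm of this remainder is |f|^2 - |<f, g>|^2 / |g|^2. *)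
have := normsq_ge0 (fun x => - (inner f g / (normsq g)%:C) * g x + f x).
rewrite normsq_lin// (innerC Lf Lg).
have -> : inner f g / (normsq g)%:C = inner f g * ((normsq g)^-1)%:C.
  by rewrite -(rmorphV (real_complex R)) ?unitfE.
rewrite !mulNr mulrAC nsqE.
have -> : nsq (- (inner f g * ((normsq g)^-1)%:C)) = nsq (inner f g) / normsq g ^+ 2.
  by rewrite -mulNr nsqM nsqC /nsq !reimE !sqrrN exprVn.
rewrite !reimE /=.
have -> : nsq (inner f g) / normsq g ^+ 2 * normsq g = nsq (inner f g) / normsq g.
  by rewrite expr2 invfM mulrA mulfVK.
rewrite mulr0 subr0 => H.
rewrite -ler_pdivrMr//; move: H; lra.
Qed.

End L2Space.

(** * Orthogonal combinations, adjoints and spectral projections *)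

Section SpectralBound.
Context d (T : measurableType d) (R : realType).
Variable mu : {measure set T -> \bar R}.
Local Notation re := complex.Re.
Local Notation im := complex.Im.
Local Notation L2 := (L2 mu).
Local Notation inner := (inner mu).
Local Notation aeq := (aeq mu).
Local Notation normsq := (normsq mu).
Implicit Types f g h : T -> R[i].

(** Orthogonality to the phi k is a system of N homogeneous linear equations in n > N unknowns; a
    solution is a nonzero row in the kernel of the matrix of inner products. *)
Lemma exists_orthogonal_comb N (phi : 'I_N -> T -> R[i]) n
    (u : 'I_n -> T -> R[i]) :
  (forall k, L2 (phi k)) -> (forall i, L2 (u i)) -> (N < n)%N ->
  exists a : 'I_n -> R[i], (exists i, a i != 0) /\
    forall k, inner (fun x => \sum_(i < n) a i * u i x) (phi k) = 0.
Proof.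
move=> Lphi Lu Nn.
pose G : 'M[R[i]]_(n, N) := \matrix_(i, k) inner (u i) (phi k).
have : kermx G != 0.
  rewrite -mxrank_eq0 mxrank_ker -lt0n subn_gt0.
  exact: leq_ltn_trans (rank_leq_col G) Nn.
case/rowV0Pn => v /sub_kermxP vG /rV0Pn[i vi].
exists (fun j => v 0 j); split; first by exists i.
move=> k; rewrite inner_sum//.
have := congr1 (fun A : 'rV_N => A 0 k) vG; rewrite !mxE => vG0; rewrite -[RHS]vG0.
by apply: eq_bigr => j _; rewrite mxE.
Qed.

(** The default of the choice is the zero operator; the bounds below treat the two cases
    separately. *)
Lemma adjointP (K : (T -> R[i]) -> T -> R[i]) :
  is_adjoint mu K (adjoint mu K) \/ adjoint mu K = fun _ _ => 0.
Proof.
have [[L KL]|noL] := pselect (exists L, is_adjoint mu K L).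
  by left; apply: (@xgetPex _ _ [set L | is_adjoint mu K L]); exists L.
by right; apply: xgetPN => L KL; apply: noL; exists L.
Qed.

Lemma inner_scale_real (r : R) f g : L2 f -> L2 g ->
  inner (fun x => r%:C * f x) g = r%:C * inner f g.
Proof.
move=> Lf Lg; have := inner_lin r%:C Lf (L2_0 mu) Lg.
by rewrite inner0l addr0; under eq_fun do rewrite addr0.
Qed.

Lemma L2_scale (a : R[i]) f : L2 f -> L2 (fun x => a * f x).
Proof. by move=> Lf; have := L2_lin a Lf (L2_0 mu); under eq_fun do rewrite addr0. Qed.

Lemma linear_op0 P : linear_op mu P -> aeq (P (fun=> 0)) (fun=> 0).
Proof.
case=> LP _ /(_ 1 _ _ (L2_0 mu) (L2_0 mu)).
rewrite (_ : (fun x : T => 1 * 0 + 0) = fun=> 0); last first.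
  by apply/funext => x; rewrite mulr0 addr0.
apply: filterS => x.
rewrite mul1r => /(congr1 (fun z => z - P (fun=> 0) x)).
by rewrite subrr addrK => <-.
Qed.

Lemma linear_op_sum P n (a : 'I_n -> R[i]) (u : 'I_n -> T -> R[i]) :
  linear_op mu P -> (forall i, L2 (u i)) ->
  aeq (P (fun x => \sum_(i < n) a i * u i x))
      (fun x => \sum_(i < n) a i * P (u i) x).
Proof.
move=> lP; elim: n a u => [|n IH] a u Lu.
  have := linear_op0 lP.
  rewrite (_ : (fun x => \sum_(i < 0) a i * u i x) = fun=> 0); last first.
    by apply/funext => x; rewrite big_ord0.
  by apply: filterS => x ->; rewrite big_ord0.
rewrite (_ : (fun x => \sum_(i < n.+1) a i * u i x) = (fun x => a ord0 * u ord0 x +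
    \sum_(i < n) a (lift ord0 i) * u (lift ord0 i) x)); last first.
  by apply/funext => x; rewrite big_ord_recl.
have [_ _ linP] := lP.
have Ls : L2 (fun x => \sum_(i < n) a (lift ord0 i) * u (lift ord0 i) x).
  exact: L2_sum.
apply: aeq_trans (linP _ _ _ (Lu _) Ls) _.
have := IH (fun i => a (lift ord0 i)) (fun i => u (lift ord0 i)) (fun i => Lu _).
by apply: filterS => x ->; rewrite big_ord_recl.
Qed.

(** * Operators bounded by B on the orthogonal complement of N functions *)

Variables (N : nat) (phi : 'I_N -> T -> R[i]) (K : (T -> R[i]) -> T -> R[i]).
Variable B : R.
Hypothesis Lphi : forall k, L2 (phi k).
Hypothesis LK : forall f, L2 f -> L2 (K f).
Hypothesis B_ge0 : 0 <= B.
Hypothesis KB : forall f, L2 f -> (forall k, inner f (phi k) = 0) ->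
  normsq (K f) <= B ^+ 2 * normsq f.

(** Among N + 1 orthonormal eigenvectors with sigma i >= s some nonzero combination f is orthogonal
    to all phi k. On it |K f|^2 is at least s^2 |f|^2 by the eigenvalue equations and at most B^2
    |f|^2 by hypothesis. *)
Lemma singular_value_le : (singular_value mu K N.+1 <= B%:E)%E.
Proof.
apply: ge_ereal_sup => _ [s [->|[s0 [u [sg [[Lu ou] H]]]]] <-].
  by rewrite lee_fin.
have [a [[i0 ai0] fphi]] := exists_orthogonal_comb Lphi Lu (ltnSn N).
set f := (fun x => \sum_(i < N.+1) a i * u i x) in fphi.
have Lf : L2 f by exact: L2_sum.
have fu i : inner f (u i) = a i.
  rewrite /f inner_sum// (bigD1 i)//= ou eqxx mulr1 big1 ?addr0// => j ji.
  by rewrite ou (negbTE ji) mulr0.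
have uf i : inner (u i) f = conjc (a i) by rewrite innerC// fu.
have nf : normsq f = \sum_(i < N.+1) nsq (a i).
  have := inner_self mu f; rewrite {1}/f inner_sum// => /(congr1 (@complex.Re R)).
  rewrite [RHS]/= => <-; rewrite (raddf_sum (@complex.Re R : Rcomplex R -> R)).
  by apply: eq_bigr => i _; rewrite uf nsqE.
have nf0 : 0 < normsq f.
  rewrite nf (bigD1 i0)//= ltr_wpDr//; first by rewrite sumr_ge0// => *; exact: nsq_ge0.
  by rewrite lt_neqAle nsq_ge0 andbT eq_sym; apply: contra ai0 => /eqP/nsq_eq0->.
(* With the default adjoint 0 the eigenvalue equation, paired with u 0, gives sigma 0 = 0, against 0
   < s <= sigma 0. *)
have [[[LL Lae _] adjL]|L0] := adjointP K; last first.
  have [s_sg] := H ord0; rewrite L0 => /(inner_aeql (L2_0 mu)).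
  move=> /(_ (u ord0) (L2_scale _ (Lu _)) (Lu _)).
  rewrite inner0l inner_scale_real// ou eqxx mulr1 => /(congr1 (@complex.Re R))/=.
  move/esym/eqP; rewrite expf_eq0/= => /eqP sg0.
  by move: s0; rewrite ltNge -sg0 s_sg.
(* The adjoint relation and conjugate symmetry, each used twice, move the operator from f to u i,
   where the eigenvalue equation applies. *)
have uLKf i : inner (u i) (adjoint mu K (K f)) = (sg i ^+ 2)%:C * conjc (a i).
  have [s_sg e] := H i.
  rewrite -adjL//; last exact: LK.
  rewrite innerC; [|exact: LK..].
  rewrite adjL//; last exact: LK.
  rewrite -innerC//; last exact/LL/LK.
  rewrite (inner_aeql _ _ _ e)// ?inner_scale_real ?uf//; first exact/LL/LK.
  exact: L2_scale.
have nKf : normsq (K f) = \sum_(i < N.+1) sg i ^+ 2 * nsq (a i).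
  have := inner_self mu (K f); rewrite adjL//; last exact: LK.
  rewrite {1}/f inner_sum//; last exact/LL/LK.
  move/(congr1 (@complex.Re R)).
  rewrite [RHS]/= => <-; rewrite (raddf_sum (@complex.Re R : Rcomplex R -> R)).
  by apply: eq_bigr => i _; rewrite uLKf mulrCA nsqE -(rmorphM (real_complex R)).
have : s ^+ 2 * normsq f <= B ^+ 2 * normsq f.
  apply: le_trans (KB Lf fphi); rewrite nKf nf mulr_sumr ler_sum// => i _.
  rewrite ler_wpM2r ?nsq_ge0//; have [s_sg _] := H i.
  by rewrite lerXn2r// nnegrE ltW// (lt_le_trans s0).
by rewrite ler_pM2r// lee_fin ler_sqr// nnegrE ltW.
Qed.

(** The left side is |K f|^2 for a true adjoint, and 0 for the default one. *)
Lemma inner_adjoint_le f : L2 f -> (forall k, inner f (phi k) = 0) ->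
  re (inner (adjoint mu K (K f)) f) <= B ^+ 2 * normsq f.
Proof.
move=> Lf fphi; have [[[LL _ _] adjL]|->] := adjointP K; last first.
  by rewrite inner0l/= mulr_ge0 ?sqr_ge0// normsq_ge0.
have LLK := LL _ (LK Lf).
by rewrite innerC// re_conj -adjL ?inner_self /= ?KB//; exact: LK.
Qed.

Lemma spectral_projP (S : (T -> R[i]) -> T -> R[i]) :
  is_spectral_measure mu S (spectral_proj mu S) \/
  spectral_proj mu S = fun _ _ _ => 0.
Proof.
have [[E SE]|noE] := pselect (exists E, is_spectral_measure mu S E).
  by left; apply: (@xgetPex _ _ [set E | is_spectral_measure mu S E]); exists E.
by right; apply: xgetPN => E SE; apply: noE; exists E.
Qed.

(* [nu], the spectral measure of [f], lives on [D], where [l > eps]; hence a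
   mean value at most [eps] forces [nu] to vanish. *)
Lemma spectral_range_eq0 (S : (T -> R[i]) -> T -> R[i]) E
    (D : set (measurableTypeR R)) eps f :
  is_spectral_measure mu S E -> measurable D -> (forall l, D l -> eps < l) ->
  L2 f -> aeq (E D f) f -> re (inner (S f) f) <= eps * normsq f ->
  normsq f = 0.
Proof.
move=> [projE E0T EI /(_ f)nuE] mD Deps Lf EDf Sf.
have [nu [nuP nui Snu]] := nuE Lf.
have LE D' : measurable D' -> L2 (E D' f).
  by move=> /projE[[LED _ _] _ _]; exact: LED.
have nuT : nu setT = (normsq f)%:E.
  rewrite nuP// (inner_aeql _ _ _ (E0T _ Lf).2)// ?inner_self//.
  exact: LE.
(* Since E D f = f, the function E (~[D) f equals E (~] D) (E D f) = E set0 f = 0. *)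
have nuDC : nu (~` D) = 0%E.
  have mDC : measurable (~` D) by exact: measurableC.
  rewrite nuP//.
  have : aeq (E (~` D) f) (fun=> 0).
    have [[_ aeE _] _ _] := projE _ mDC.
    apply: aeq_trans (aeq_sym (aeE _ _ (LE _ mD) Lf EDf)) _.
    have := aeq_sym (EI _ _ _ mDC mD Lf); rewrite setICl => H.
    exact: aeq_trans H (E0T _ Lf).1.
  by move=> H; rewrite (inner_aeql _ (L2_0 mu) _ H) ?inner0l//; exact: LE.
have nufin : (nu setT < +oo)%E by rewrite nuT ltry.
have ceps : nu.-integrable setT (EFin \o (fun=> eps : R)).
  apply: measurable_bounded_integrable => //.
  by exists `|eps|; split; [exact: num_real|move=> M /ltW ? x _].
have gi := integrableB measurableT nui ceps.
have gi' : nu.-integrable setT (EFin \o (fun l : R => l - eps)) by [].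
have g_le0 : Rintegral nu setT (fun l => l - eps) <= 0.
  rewrite RintegralB// Rintegral_cst// nuT /= subr_le0.
  by move: Sf; rewrite Snu.
have aeD : {ae nu, forall l, D l}.
  by exists (~` D); split=> //; exact: measurableC.
have absg : (\int[nu]_l `|(l - eps)%:E|)%E = (Rintegral nu setT (fun l => l - eps))%:E.
  rewrite /Rintegral fineK; last exact: integrable_fin_num gi'.
  apply: ae_eq_integral => //.
  - by apply: measurableT_comp => //; exact: measurable_int gi'.
  - exact: measurable_int gi'.
  - by apply: filterS aeD => l Dl _; rewrite /= ger0_norm// subr_ge0 ltW ?Deps.
have absg0 : (\int[nu]_l `|(l - eps)%:E| = 0)%E.
  by apply/eqP; rewrite eq_le integral_ge0// andbT absg lee_fin.
(* Now l - eps is both positive and zero for nu-almost every l, so the whole line is nu-null, while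
   its nu-measure is |f|^2. *)
have := (ae_eq_integral_abs nu measurableT (measurable_int nu gi')).1 absg0.
move=> g0; have [Z [mZ Z0 /(_ _)TZ]] : {ae nu, forall l : R, False}.
  apply: filterS2 aeD g0 => l /Deps + /(_ I)/= [] /eqP.
  by rewrite subr_eq0 => + /eqP le; rewrite le ltxx.
have : (nu setT <= nu Z)%E.
  by apply: le_measure; rewrite ?inE// => x _; apply: TZ.
by rewrite nuT Z0 lee_fin => n0; apply/eqP; rewrite eq_le n0 normsq_ge0.
Qed.

(** If more than N images under the spectral projection were independent, a nontrivial combination f
    of them would be orthogonal to all phi k. Then <S f, f> <= B^2 |f|^2 <= eps |f|^2 although f
    lies in the spectral subspace above eps, so f = 0, against independence. *)
Lemma Lambda_le eps : B ^+ 2 <= eps ->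
  (Lambda mu eps (fun f => adjoint mu K (K f)) <= N%:R%:E)%E.
Proof.
move=> Beps; apply: ge_ereal_sup => _ [n [u [Lu li]] <-].
rewrite lee_fin ler_nat leqNgt; apply/negP => Nn.
have n0 : (0 < n)%N by exact: leq_ltn_trans Nn.
set S := fun f => _ in li; set D := `]eps, _[%classic in li.
(* Under the default value all images are 0, and n > 0 zero functions are dependent. *)
have [SE|S0] := spectral_projP S; last first.
  suff /eqP : (1 : R[i]) = 0 by rewrite oner_eq0.
  apply: (li (fun=> 1) _ (Ordinal n0)); rewrite S0; apply: nearW => x.
  by rewrite big1// => i _; rewrite mulr0.
have [/(_ D)projD _ _ _] := SE.
have mD : measurable (D : set (measurableTypeR R)) by exact: measurable_itv.
have [lP PP _] := projD mD.
have [LP _ _] := lP.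
set P := spectral_proj mu S D in li projD lP PP LP.
have LPu i : L2 (P (u i)) by exact: LP.
have [a [[i0 ai0] fphi]] := exists_orthogonal_comb Lphi LPu Nn.
set f := (fun x => _) in fphi.
have Lf : L2 f by exact: L2_sum.
have Pf : aeq (P f) f.
  apply: aeq_trans (linear_op_sum a lP LPu) _.
  rewrite /f; have : {ae mu, forall x, forall i, P (P (u i)) x = P (u i) x}.
    by apply: filter_forall => i; exact: PP.
  by apply: filterS => x H; apply: eq_bigr => i _; rewrite H.
have f0 : normsq f = 0.
  apply: (spectral_range_eq0 (eps := eps) SE mD _ Lf Pf).
  - by move=> l; rewrite /D /= in_itv/= => /andP[].
  - rewrite /S; apply: le_trans (inner_adjoint_le Lf fphi) _.
    by rewrite ler_wpM2r// normsq_ge0.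
have := li a (normsq_eq0 Lf f0) i0.
by move: ai0 => /eqP.
Qed.

End SpectralBound.

(** * The Taylor remainder of exp(i t) *)

Section ExpTaylor.
Variable R : realType.
Local Notation re := complex.Re.
Local Notation im := complex.Im.
Implicit Types (t p q r : R) (N : nat).

Definition expi_taylor N t : R[i] := \sum_(k < N) (t ^+ k / k`!%:R)%:C * 'i ^+ k.

Definition expi_rem N t : R[i] := expi t - expi_taylor N t.

Lemma expiD s t : expi (s + t) = expi s * expi t.
Proof.
by apply: complex_ext; rewrite !reimE /= ?cosD ?sinD//; ring.
Qed.

Lemma expiN t : expi (- t) = conjc (expi t).
Proof. by rewrite /expi cosN sinN. Qed.

Lemma nsq_expi t : nsq (expi t) = 1.
Proof. by rewrite /nsq /= cos2Dsin2. Qed.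

Lemma expi_taylorN N t : expi_taylor N (- t) = conjc (expi_taylor N t).
Proof.
rewrite /expi_taylor rmorph_sum; apply: eq_bigr => k _ /=.
have ci : conjc ('i : R[i]) = - 'i by apply: complex_ext; rewrite !reimE /= ?oppr0.
transitivity (conjc (t ^+ k / k`!%:R)%:C * conjc 'i ^+ k); last first.
  by rewrite -rmorphXn -rmorphM.
rewrite ci conjc_real (exprNn 'i) mulrCA mulrA; congr (_ * _).
by rewrite (exprNn t) -mulrA (rmorphMsign (real_complex R)).
Qed.

Lemma expi_remN N t : expi_rem N (- t) = conjc (expi_rem N t).
Proof. by rewrite /expi_rem expiN expi_taylorN rmorphB. Qed.

Lemma is_derive_exprn_fact n t :
  is_derive t 1 (fun s => s ^+ n.+1 / n.+1`!%:R) (t ^+ n / n`!%:R).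
Proof.
have := is_deriveZ (n.+1`!%:R^-1) (is_deriveX n.+1 (is_derive_id t (1 : R))).
rewrite (_ : _ \*: _ = fun s => s ^+ n.+1 / n.+1`!%:R); last first.
  by apply/funext => s; rewrite /= exprfctE /GRing.scale /= mulrC.
move=> H; apply: is_derive_eq H _; rewrite /GRing.scale /= mulr1 factS natrM/=.
by rewrite invfM mulrACA mulVf ?pnatr_eq0// mul1r mulrC.
Qed.

Lemma expi_taylorS N t :
  expi_taylor N.+1 t = expi_taylor N t + (t ^+ N / N`!%:R)%:C * 'i ^+ N.
Proof. by rewrite /expi_taylor big_ord_recr. Qed.

Lemma re_iS N : re ('i ^+ N.+1 : R[i]) = - im ('i ^+ N : R[i]).
Proof. by rewrite exprSr reM /= mulr0 mulr1 sub0r. Qed.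

Lemma im_iS N : im ('i ^+ N.+1 : R[i]) = re ('i ^+ N : R[i]).
Proof. by rewrite exprSr imM /= mulr0 mulr1 addr0. Qed.

(** Differentiation lowers the order of the Taylor polynomial and multiplies it by ['i]; the real
    part of i z is - im z. *)
Lemma is_derive_re_taylor N t :
  is_derive t 1 (fun s => re (expi_taylor N.+1 s)) (- im (expi_taylor N t)).
Proof.
elim: N => [|N IH].
  rewrite (_ : (fun _ => _) = cst 1).
    by apply: is_derive_eq; rewrite /expi_taylor big_ord0 /= oppr0.
  apply/funext => s.
  by rewrite expi_taylorS /expi_taylor big_ord0 !reimE /= divr1; ring.
rewrite (_ : (fun _ => _) = (fun s => re (expi_taylor N.+1 s)) +
    (- im ('i ^+ N : R[i])) \*: (fun s => s ^+ N.+1 / N.+1`!%:R)); last first.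
  apply/funext => s.
  by rewrite expi_taylorS reD reM re_iS /= mul0r subr0 mulrC.
have := is_deriveD IH (is_deriveZ (- im ('i ^+ N : R[i])) (is_derive_exprn_fact N t)).
move=> H; apply: is_derive_eq H _.
by rewrite /GRing.scale /= expi_taylorS imD imM /=; ring.
Qed.

Lemma is_derive_im_taylor N t :
  is_derive t 1 (fun s => im (expi_taylor N.+1 s)) (re (expi_taylor N t)).
Proof.
elim: N => [|N IH].
  rewrite (_ : (fun _ => _) = cst 0).
    by apply: is_derive_eq; rewrite /expi_taylor big_ord0.
  by apply/funext => s; rewrite expi_taylorS /expi_taylor big_ord0 !reimE /=; ring.
rewrite (_ : (fun _ => _) = (fun s => im (expi_taylor N.+1 s)) +
    (re ('i ^+ N : R[i])) \*: (fun s => s ^+ N.+1 / N.+1`!%:R)); last first.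
  apply/funext => s.
  by rewrite expi_taylorS imD imM im_iS /= mul0r addr0 mulrC.
have := is_deriveD IH (is_deriveZ (re ('i ^+ N : R[i])) (is_derive_exprn_fact N t)).
move=> H; apply: is_derive_eq H _.
by rewrite /GRing.scale /= expi_taylorS reD reM /=; ring.
Qed.

Lemma expi_rem0 N : expi_rem N.+1 0 = 0.
Proof.
rewrite /expi_rem; elim: N => [|N IH].
  rewrite expi_taylorS /expi_taylor big_ord0 /expi cos0 sin0.
  by rewrite expr0 divr1 mulr1 add0r; apply: complex_ext; rewrite !reimE /= subrr.
by rewrite expi_taylorS expr0n mul0r mul0r addr0.
Qed.

Lemma is_derive_re_rem N t :
  is_derive t 1 (fun s => re (expi_rem N.+1 s)) (- im (expi_rem N t)).
Proof.
have := is_deriveB (is_derive_cos t) (is_derive_re_taylor N t).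
rewrite (_ : cos - _ = fun s => re (expi_rem N.+1 s)); last first.
  by apply/funext => s; rewrite /expi_rem !reimE.
by move=> H; apply: is_derive_eq H _; rewrite /expi_rem !reimE /=; ring.
Qed.

Lemma is_derive_im_rem N t :
  is_derive t 1 (fun s => im (expi_rem N.+1 s)) (re (expi_rem N t)).
Proof.
have := is_deriveB (is_derive_sin t) (is_derive_im_taylor N t).
rewrite (_ : sin - _ = fun s => im (expi_rem N.+1 s)); last first.
  by apply/funext => s; rewrite /expi_rem !reimE.
by move=> H; apply: is_derive_eq H _; rewrite /expi_rem !reimE.
Qed.

(* Differentiation lowers N and permutes the functions [p re rem + q im rem],
   and [expi_rem N.+1] vanishes at 0: this gives the induction on N. *)
Lemma expi_rem_dir N p q r t : 0 <= r -> 0 <= t -> p ^+ 2 + q ^+ 2 <= r ^+ 2 ->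
  p * re (expi_rem N t) + q * im (expi_rem N t) <= r * (t ^+ N / N`!%:R).
Proof.
move=> r0; elim: N p q t => [|N IH] p q t t0 pqr.
  rewrite /expi_rem /expi_taylor big_ord0 subr0 expr0 divr1 mulr1 /=.
  (* Cauchy-Schwarz in the plane: adding the square of p sin t - q cos t gives p^2 + q^2. *)
  have CS : (p * cos t + q * sin t) ^+ 2 <= r ^+ 2.
    apply: le_trans pqr; have := cos2Dsin2 t; have := sqr_ge0 (p * sin t - q * cos t).
    move: (cos t) (sin t) => c s ps cs.
    have -> : p ^+ 2 + q ^+ 2 = (p ^+ 2 + q ^+ 2) * (c ^+ 2 + s ^+ 2).
      by rewrite cs mulr1.
    by move: ps; lra.
  rewrite leNgt; apply/negP => rlt; move: CS; apply/negP; rewrite -ltNge.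
  by rewrite ltr_pXn2r ?nnegrE// (le_trans r0)// ltW.
(* F is the gap between the two sides at order N + 1. Its derivative [dF] is the gap at order N for
   the rotated direction (q, - p), nonnegative by induction. *)
pose F : R -> R := (r \*: (fun s => s ^+ N.+1 / N.+1`!%:R)
  - p \*: (fun s => re (expi_rem N.+1 s)) - q \*: (fun s => im (expi_rem N.+1 s))).
pose dF s := r * (s ^+ N / N`!%:R) - (q * re (expi_rem N s) + - p * im (expi_rem N s)).
have FdF (s : R) : is_derive s (1 : R) F (dF s).
  have := is_deriveB (is_deriveB (is_deriveZ r (is_derive_exprn_fact N s))
    (is_deriveZ p (is_derive_re_rem N s))) (is_deriveZ q (is_derive_im_rem N s)).
  by move=> H; apply: is_derive_eq H _; rewrite /GRing.scale /= /dF; ring.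
have FE s : F s = r * (s ^+ N.+1 / N.+1`!%:R) - p * re (expi_rem N.+1 s)
  - q * im (expi_rem N.+1 s) by [].
have F0 : F 0 = 0 by rewrite FE expi_rem0 expr0n /= mul0r !mulr0 !subr0.
have : F 0 <= F t.
  apply: (@ger0_derive1_ndecry _ _ 0) => //.
  - move=> x; rewrite in_itv/= andbT => x0.
    rewrite derive1E; have [_ ->] := FdF x; rewrite /dF subr_ge0.
    by apply: IH; [exact: ltW|rewrite sqrrN addrC].
  - apply: continuous_subspaceT => x.
    apply: differentiable_continuous; apply/derivable1_diffP.
    by have [] := FdF x.
by rewrite F0 FE; lra.
Qed.

(** The directional bound, taken in the direction of the remainder z itself with r = |z|, reads
    |z|^2 <= |z| b. Negative t reduces to positive t by conjugation. *)
Lemma nsq_expi_rem N t : nsq (expi_rem N t) <= (`|t| ^+ N / N`!%:R) ^+ 2.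
Proof.
wlog t0 : t / 0 <= t.
  move=> H; have [/H//|/ltW t0] := leP 0 t.
  by rewrite -nsq_conj -expi_remN -normrN H// oppr_ge0.
rewrite ger0_norm//; set b := _ / _.
have b0 : 0 <= b by rewrite divr_ge0// exprn_ge0.
set z := expi_rem N t.
have := @expi_rem_dir N (re z) (im z) (Num.sqrt (nsq z)) t (sqrtr_ge0 _) t0.
rewrite sqr_sqrtr ?nsq_ge0// => /(_ (lexx _)); rewrite -/z -!expr2 -/(nsq z) -/b.
have := sqrtr_ge0 (nsq z); rewrite -{2 4}(sqr_sqrtr (nsq_ge0 z)).
move: (Num.sqrt _) => x; rewrite le_eqVlt => /predU1P[<- _|x0].
  by rewrite expr0n/= sqr_ge0.
rewrite expr2 ler_pM2l// => xb.
by rewrite -expr2 lerXn2r// nnegrE ltW.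
Qed.

(** The difference is [expi t] times the remainder of order 1 at s - t. *)
Lemma nsq_expiB s t : nsq (expi s - expi t) <= (s - t) ^+ 2.
Proof.
have -> : expi s - expi t = expi t * expi_rem 1 (s - t).
  rewrite /expi_rem expi_taylorS /expi_taylor big_ord0 add0r expr0 divr1 mulr1.
  by rewrite mulrBr mulr1 -expiD (addrC t) subrK.
rewrite nsqM nsq_expi mul1r (le_trans (nsq_expi_rem _ _))//.
by rewrite expr1 divr1 real_normK ?num_real.
Qed.

End ExpTaylor.

(** * Lebesgue measurable sets and their dilations *)

Section LebesgueMeasurable.
Variable R : realType.
Local Notation re := complex.Re.
Local Notation im := complex.Im.
Local Notation leb := (leb R).
Local Notation lebT := (lebT R).
Implicit Types (A E : set R) (c : R).

(** Since [leb] is the outer measure on every subset, the scaling law can be proved for arbitrary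
    sets first and then used to obtain measurability. *)
Lemma leb_outer (X : set R) : leb X = ((wlength (@idfun R))^*)%mu X.
Proof. by []. Qed.

Lemma borel_lebesgue_measurable (E : set (measurableTypeR R)) :
  measurable E -> measurable (E : set lebT).
Proof. by move=> mE; exact: sub_caratheodory. Qed.

Lemma measurable_fun_borel (f : R -> R) :
  measurable_fun [set: measurableTypeR R] f ->
  measurable_fun [set: lebT] (f : lebT -> R).
Proof.
move=> mf _ Y mY; apply: borel_lebesgue_measurable; exact: mf.
Qed.

Lemma continuous_measurable_leb (f : R -> R) :
  continuous f -> measurable_fun [set: lebT] (f : lebT -> R).
Proof. by move=> /continuous_measurable_fun/measurable_fun_borel. Qed.

Lemma dilateE c E x : c != 0 -> dilate c E x <-> E (c^-1 * x).
Proof.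
move=> c0; split=> [[y Ey <-]|Ex]; first by rewrite mulrA mulVf// mul1r.
by exists (c^-1 * x) => //; rewrite mulrA mulfV// mul1r.
Qed.

Lemma dilate_itvoc c (a b : R) : 0 < c ->
  dilate c `]a, b]%classic = `]c * a, c * b]%classic.
Proof.
move=> c0; apply/seteqP; split=> x /=.
  move=> [y]; rewrite !in_itv/= => /andP[? ?] <-.
  by rewrite ltr_pM2l// ler_pM2l//; apply/andP.
move=> H; apply/dilateE; first by rewrite gt_eqF.
move: H; rewrite /= !in_itv/= => /andP[? ?].
rewrite mulrC ltr_pdivlMr// ler_pdivrMr// mulrC.
by apply/andP; split=> //; rewrite mulrC.
Qed.

Lemma wlength_dilate c (X : set (ocitv_type R)) : 0 < c -> measurable X ->
  measurable (dilate c X : set (ocitv_type R)) /\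
  wlength (@idfun R) (dilate c X) = (c%:E * wlength (@idfun R) X)%E.
Proof.
move=> c0 /= [[a b] _ <-] /=; rewrite dilate_itvoc//; split.
  by exists (c * a, c * b).
rewrite !wlength_itv /= !lte_fin ltr_pM2l//; case: ifPn => ab; last by rewrite mule0.
by rewrite -EFinD -EFinM mulrBr.
Qed.

(** Dilating a cover of E by half-open intervals gives a cover of [dilate c E] whose lengths are
    multiplied by c. *)
Lemma outer_dilate_le c E : 0 < c -> (leb (dilate c E) <= c%:E * leb E)%E.
Proof.
move=> c0; rewrite -lee_pdivrMl// !leb_outer.
apply: le_ereal_inf_tmp => _ [F [mF EF] <-].
rewrite lee_pdivrMl//.
apply: ereal_inf_lbound.
exists (fun k => dilate c (F k)).
  split; first by move=> k; have [] := wlength_dilate c0 (mF k).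
  by move=> _ [x /EF [k _ Fk] <-]; exists k => //; exists x.
rewrite -nneseriesZl//.
  by apply: eq_eseriesr => k _; have [_ ->] := wlength_dilate c0 (mF k).
Qed.

Lemma dilateK c E : c != 0 -> dilate c^-1 (dilate c E) = E.
Proof.
move=> c0; apply/seteqP; split => x.
  by move=> [y] [z Ez <-] <-; rewrite mulrA mulVf// mul1r.
by move=> Ex; exists (c * x); [exists x|rewrite mulrA mulVf// mul1r].
Qed.

(** The reverse inequality is the previous one for the factor c^-1 and the set [dilate c E]. *)
Lemma leb_dilate c E : 0 < c -> leb (dilate c E) = (c%:E * leb E)%E.
Proof.
move=> c0; apply/eqP; rewrite eq_le outer_dilate_le//=.
rewrite -lee_pdivlMl//.
have cV0 : 0 < c^-1 by rewrite invr_gt0.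
have := outer_dilate_le (dilate c E) cV0.
by rewrite dilateK// gt_eqF.
Qed.

Lemma dilateI c X E : c != 0 ->
  dilate c X `&` dilate c E = dilate c (X `&` E).
Proof.
move=> c0; apply/seteqP; split=> x.
  by move=> [/dilateE-/(_ c0) ? /dilateE-/(_ c0) ?]; apply/dilateE.
by move=> /dilateE-/(_ c0) [? ?]; split; apply/dilateE.
Qed.

Lemma dilateC c E : c != 0 -> ~` dilate c E = dilate c (~` E).
Proof.
move=> c0; apply/seteqP; split=> x.
  by move=> nx; apply/dilateE => // ?; apply: nx; apply/dilateE.
by move=> /dilateE-/(_ c0) nx /dilateE-/(_ c0).
Qed.

(** Caratheodory's criterion for E, tested on [dilate c^-1 X] and multiplied by c, is the criterion
    for [dilate c E] tested on X. *)
Lemma lebesgue_measurable_dilate c E : 0 < c -> lebesgue_measurable E ->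
  lebesgue_measurable (dilate c E).
Proof.
move=> c0 mE.
have Ecara (X : set R) : leb X = (leb (X `&` E) + leb (X `&` ~` E))%E := mE X.
suff Dcara (X : set R) :
    leb X = (leb (X `&` dilate c E) + leb (X `&` ~` dilate c E))%E by exact: Dcara.
have cn0 : c != 0 by rewrite gt_eqF.
have -> : X = dilate c (dilate c^-1 X).
  by rewrite -{1}(invrK c) dilateK// invr_neq0.
move: (dilate c^-1 X) => {}X.
rewrite dilateC// !dilateI//.
rewrite !leb_dilate// -ge0_muleDr; [|exact: outer_measure_ge0..].
by rewrite -Ecara.
Qed.

End LebesgueMeasurable.

(* The hints of the library do not see through the definition of [leb]. *)
Local Instance leb_ae_filter (R : realType) :
  Filter (nbhs (almost_everywhere (leb R))).
Proof. exact: ae_filter_ringOfSetsType. Qed.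

(** * The essential diameter and the essential midpoint *)

Section EssentialDiameter.
Variable R : realType.
Local Notation leb := (leb R).
Local Notation lebT := (lebT R).
Implicit Types (A E : set R).

Lemma measurable_itv_leb (i : interval R) : measurable ([set` i] : set lebT).
Proof. by apply: borel_lebesgue_measurable; exact: measurable_itv. Qed.

Lemma leb_prodE (X Y : set lebT) : measurable X -> measurable Y ->
  (leb \x leb)%E (X `*` Y) = (leb X * leb Y)%E.
Proof.
move=> mX mY.
exact: (product_measure1E leb (@completed_lebesgue_measure R) mX mY).
Qed.

(** A nonnegative function has a nonnegative essential supremum only if the space is not null. *)
Lemma leb_prod_gt0 : (0 < (leb \x leb)%E [set: lebT * lebT])%E.
Proof.
have := @measurable_itv_leb `[0, 1]; set I := [set` _] => mI.
have I1 : leb I = 1%E.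
  rewrite -[LHS]/(lebesgue_measure I) lebesgue_measure_itv/=.
  by rewrite lte_fin ltr01 oppr0 adde0.
apply: (@lt_le_trans _ _ ((leb \x leb)%E (I `*` I))).
  by rewrite leb_prodE// I1 mule1 lte_fin ltr01.
by apply: le_measure; rewrite ?inE//; exact: measurableX.
Qed.

Lemma bounded_set_norm_le A : bounded_set A -> exists M, forall x, A x -> `|x| <= M.
Proof. by move=> [M [_ AM]]; exists (M + 1); apply: AM; rewrite ltrDl. Qed.

(** Makes [fine] harmless in [diam_ess]: if |x| <= M on A, the essential supremum lies between 0 and
    2 |M|. *)
Lemma diam_ess_fin A : bounded_set A ->
  @ess_sup _ (lebT * lebT)%type R (leb \x leb)%E
    (fun p : R * R => (`|p.1 - p.2| * \1_(A `*` A) p)%:E) = (diam_ess A)%:E /\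
  0 <= diam_ess A.
Proof.
move=> /bounded_set_norm_le[M AM]; rewrite /diam_ess.
set f := (fun p : R * R => _); set s := ess_sup _ _.
have f0 p : (0 <= f p)%E by rewrite lee_fin mulr_ge0// indicE ler0n.
have s0 : (0 <= s)%E.
  by apply: ess_sup_gee; [exact: leb_prod_gt0|exact: nearW].
have sM : (s <= (2 * `|M|)%:E)%E.
  apply/ess_supP; apply: nearW => -[x y]; rewrite lee_fin indicE /=.
  have [|_] := boolP ((x, y) \in _); last by rewrite mulr0 mulr_ge0.
  rewrite inE /= mulr1 => -[/AM xM /AM yM].
  rewrite (le_trans (ler_normB _ _))// mulr_natl mulr2n.
  by rewrite lerD// (le_trans _ (ler_norm M)).
have sfin : s \is a fin_num by rewrite ge0_fin_numE// (le_lt_trans sM)// ltry.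
by rewrite fineK//; split=> //; exact: fine_ge0.
Qed.

Lemma diam_ess_ge0 A : bounded_set A -> 0 <= diam_ess A.
Proof. by move=> /diam_ess_fin[]. Qed.

(** The rectangle X x Y lies in the null set of pairs that exceed the essential supremum, so the
    product of the two measures is 0. *)
Lemma diam_ess_separated A (X Y : set R) : bounded_set A ->
  lebesgue_measurable X -> lebesgue_measurable Y -> X `<=` A -> Y `<=` A ->
  (forall x y, X x -> Y y -> diam_ess A < `|x - y|) -> leb X = 0%E \/ leb Y = 0%E.
Proof.
move=> bA mX mY XA YA far; have [dA _] := diam_ess_fin bA.
have := @ess_sup_ge _ (lebT * lebT)%type R (leb \x leb)%E
  (fun p : R * R => (`|p.1 - p.2| * \1_(A `*` A) p)%:E).
rewrite dA => -[Z [mZ Z0 sZ]].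
have XYZ : (X `*` Y : set (lebT * lebT)) `<=` Z.
  move=> [x y] [/= Xx Yy]; apply: sZ => /=; apply/negP; rewrite -ltNge lte_fin.
  by rewrite indicE mem_set ?mulr1; [exact: far|split; [exact: XA|exact: YA]].
have : (leb X * leb Y <= (leb \x leb)%E Z)%E.
  by rewrite -leb_prodE//; apply: le_measure; rewrite ?inE//; exact: measurableX.
rewrite Z0 => XY0; have : (leb X * leb Y)%E == 0%E.
  by rewrite eq_le XY0 mule_ge0.
by rewrite mule_eq0 => /orP[] /eqP; [left|right].
Qed.

(** The center is a + [diam_ess A] / 2 with a the essential infimum of A: a part of A of positive
    measure beyond a + [diam_ess A] would be too far from the part of A near a. *)
Lemma ess_center A : lebesgue_measurable A -> bounded_set A ->
  exists x0, {ae leb, forall x, A x -> `|x - x0| <= diam_ess A / 2}.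
Proof.
move=> mA bA; have d0 := diam_ess_ge0 bA.
have [M AM] := bounded_set_norm_le bA.
have [A0|A0] := eqVneq (leb A) 0%E.
  exists 0; exists A; split=> // x /=; apply: contra_notP => nA /nA[].
pose S := [set t | {ae leb, forall x, A x -> t <= x}].
have SM : S (- M).
  by apply: nearW => x /AM; rewrite ler_norml => /andP[].
have Snull (X : set R) :
    lebesgue_measurable X -> leb X = 0%E -> {ae leb, forall x, ~ X x}.
  by move=> mX X0; exists X; split=> // x /= /contrapT.
(* Here A has positive measure: an essential lower bound above M + 1 would put all of A into a null
   set. *)
have ubM : ubound S (M + 1).
  move=> t St; rewrite leNgt; apply/negP => Mt; move/eqP: A0; apply.
  case: St => Z [mZ Z0 sZ]; apply/eqP; rewrite eq_le measure_ge0 andbT -Z0.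
  apply: le_measure; rewrite ?inE// => x Ax; apply: sZ => /(_ Ax) tx.
  have := AM _ Ax; rewrite leNgt => /negP; apply.
  rewrite (lt_le_trans _ (ler_norm _))// (lt_le_trans _ tx)//.
  by rewrite (lt_trans _ Mt)// ltrDl.
have supS : has_sup S by split; [exists (- M)|exists (M + 1)].
pose a := sup S.
(* The slacks 1 / (n + 1) give countably many exceptional null sets, which [ae_foralln] unites at
   the end. *)
have low n : {ae leb, forall x, A x -> a - n.+1%:R^-1 <= x}.
  have n0 : 0 < n.+1%:R^-1 :> R by rewrite invr_gt0.
  have [t St at_] := sup_adherent n0 supS.
  by apply: filterS St => x /[apply]; apply: le_trans; exact: ltW.
have up n : {ae leb, forall x, A x -> x <= a + diam_ess A + n.+1%:R^-1}.
  have n0 : 0 < n.+1%:R^-1 :> R by rewrite invr_gt0.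
  set e := n.+1%:R^-1 in n0 *.
  have mX : lebesgue_measurable (A `&` `]-oo, (a + e)[%classic).
    by apply: measurableI => //; exact: measurable_itv_leb.
  have mY : lebesgue_measurable (A `&` `](a + diam_ess A + e), +oo[%classic).
    by apply: measurableI => //; exact: measurable_itv_leb.
  have [||x y|X0|Y0] := diam_ess_separated bA mX mY.
  - by move=> x [].
  - by move=> x [].
  - move=> [_ /=]; rewrite in_itv/= => xa [_ /=]; rewrite in_itv/= andbT => ya.
    rewrite distrC (lt_le_trans _ (ler_norm _))//.
    by rewrite ltrBrDr; move: xa ya; lra.
  (* Were the part of A below a + e null, a + e would be an essential lower bound exceeding the
     supremum a. *)
  - exfalso; have : S (a + e).
      apply: filterS (Snull _ mX X0) => x nX Ax; rewrite leNgt; apply/negP => xa.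
      by apply: nX; split=> //=; rewrite in_itv.
    by move=> /(ub_le_sup supS.2); rewrite -/a leNgt ltrDl n0.
  - apply: filterS (Snull _ mY Y0) => x nY Ax; rewrite leNgt; apply/negP => xa.
    by apply: nY; split=> //=; rewrite in_itv/= andbT.
exists (a + diam_ess A / 2).
have := ae_foralln low; have := ae_foralln up.
apply: filterS2 => x lx ux Ax; rewrite ler_distl.
have eps0 (u v : R) : (forall n, u <= v + n.+1%:R^-1) -> u <= v.
  move=> H; apply/ler_addgt0Pr => e e0.
  near \oo => n; apply: le_trans (H n) _; rewrite lerD2l ltW//.
  by near: n; exact: (near_infty_natSinv_lt (PosNum e0)).
apply/andP; split.
  rewrite addrK; apply: eps0 => n; rewrite -lerBlDr; exact: ux.
rewrite -addrA -splitr; apply: eps0 => n; exact: lx.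
Unshelve. all: by end_near. Qed.

(** Up to a null set, A lies in the interval of length [diam_ess A] about its essential midpoint. *)
Lemma leb_le_diam_ess A : lebesgue_measurable A -> bounded_set A ->
  (leb A <= (diam_ess A)%:E)%E.
Proof.
move=> mA bA; have [x0 [Z [mZ Z0 AZ]]] := ess_center mA bA.
have d0 := diam_ess_ge0 bA.
pose I := `[x0 - diam_ess A / 2, x0 + diam_ess A / 2]%classic.
have mI : lebesgue_measurable I by exact: measurable_itv_leb.
have -> : (diam_ess A)%:E = leb (I : set lebT).
  rewrite -[RHS]/(lebesgue_measure I) lebesgue_measure_itv/= lte_fin.
  case: ltP => [_|]; first by rewrite -EFinD; congr EFin; lra.
  by move=> h; congr EFin; lra.
rewrite -[leRHS]adde0 -Z0; apply: le_trans (measureU2 leb mI mZ).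
apply: le_measure; rewrite ?inE//; first exact: measurableU.
move=> x Ax; have [Ix|nIx] := pselect (I x); [by left|right; apply: AZ => /(_ Ax)].
by rewrite ler_distl => xI; apply: nIx; rewrite /I /= in_itv.
Qed.

End EssentialDiameter.

(** * The truncated Fourier transform as inner products with waves *)

Section FourierBound.
Variable R : realType.
Local Notation re := complex.Re.
Local Notation im := complex.Im.
Local Notation leb := (leb R).
Local Notation lebT := (lebT R).
Local Notation L2 := (L2 leb).
Local Notation inner := (inner leb).
Local Notation normsq := (normsq leb).
Implicit Types (A E : set R) (f g : R -> R[i]).

(** The Lipschitz condition is squared to match bounds on [nsq], from which the real and imaginary
    parts inherit it. *)
Lemma continuous_sq_lipschitz (C : R) (h : R -> R) :
  (forall x y, (h x - h y) ^+ 2 <= C * (x - y) ^+ 2) -> continuous h.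
Proof.
move=> hC x; apply/cvgrPdist_lt => e e0.
have C0 : 0 <= C.
  by have := le_trans (sqr_ge0 _) (hC 1 0); rewrite subr0 expr1n mulr1.
(* The added 1 keeps D positive when C = 0, so that e / D is a valid radius. *)
pose D := Num.sqrt C + 1.
have D0 : 0 < D by rewrite ltr_wpDl ?sqrtr_ge0.
have CD : C <= D ^+ 2.
  by rewrite -{1}(sqr_sqrtr C0) lerXn2r ?nnegrE ?sqrtr_ge0 ?(ltW D0)// /D lerDl.
have eD : 0 < e / D by rewrite divr_gt0.
near=> y.
have xy : `|x - y| < e / D.
  by near: y; apply: cvgr_dist_lt => //; exact: cvg_id.
rewrite -ltr_sqr ?nnegrE ?(ltW e0)// real_normK ?num_real//.
apply: le_lt_trans (hC x y) _.
apply: (@le_lt_trans _ _ (D ^+ 2 * (x - y) ^+ 2)); first by rewrite ler_wpM2r ?sqr_ge0.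
rewrite -exprMn -(real_normK (num_real (D * _))) ltr_sqr ?nnegrE ?(ltW e0)//.
by rewrite normrM (gtr0_norm D0) mulrC -ltr_pdivlMr.
Unshelve. all: by end_near. Qed.

Lemma cmeas_expi (a b : R) : @cmeas _ lebT R (fun x : R => expi (a * x + b)).
Proof.
split; apply: continuous_measurable_leb.
- apply: (@continuous_sq_lipschitz (a ^+ 2)) => x y; rewrite -exprMn.
  rewrite (_ : a * (x - y) = (a * x + b) - (a * y + b)); last by ring.
  apply: le_trans (nsq_expiB _ _); rewrite /nsq !reimE.
  by rewrite lerDl sqr_ge0.
- apply: (@continuous_sq_lipschitz (a ^+ 2)) => x y; rewrite -exprMn.
  rewrite (_ : a * (x - y) = (a * x + b) - (a * y + b)); last by ring.
  apply: le_trans (nsq_expiB _ _); rewrite /nsq !reimE.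
  by rewrite lerDr sqr_ge0.
Qed.

Lemma cmeas_real (h : R -> R) : measurable_fun [set: lebT] (h : lebT -> R) ->
  @cmeas _ lebT R (fun x => (h x)%:C).
Proof. by move=> mh; split => //=; exact: measurable_cst. Qed.

Lemma cmeas_indic A : lebesgue_measurable A ->
  @cmeas _ lebT R (fun x => (\1_A x)%:C).
Proof. by move=> mA; apply: cmeas_real; exact: measurable_indic. Qed.

Lemma nsq_indicM A (x : R) (z : R[i]) : nsq ((\1_A x)%:C * z) = \1_A x * nsq z.
Proof.
by rewrite nsqM nsqC indicE; case: (x \in A); rewrite ?expr1n ?expr0n.
Qed.

Lemma leb_fin_vol A : (leb A < +oo)%E -> leb A = (vol A)%:E.
Proof. by move=> fA; rewrite fineK// ge0_fin_numE. Qed.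

Lemma vol_ge0 A : 0 <= vol A.
Proof. by rewrite fine_ge0. Qed.

Lemma integrable_indic_leb A : lebesgue_measurable A -> (leb A < +oo)%E ->
  leb.-integrable [set: lebT] (EFin \o (\1_A : lebT -> R)).
Proof.
move=> mA fA; apply/integrableP; split.
  by apply/measurable_EFinP; exact: measurable_indic.
rewrite (eq_integral (fun x : lebT => (\1_A x)%:E)).
  by rewrite integral_indic// setIT.
by move=> x _ /=; rewrite ger0_norm// indicE.
Qed.

Lemma L2_indicM A g (C : R) : lebesgue_measurable A -> (leb A < +oo)%E ->
  @cmeas _ lebT R g -> (forall x, A x -> nsq (g x) <= C) -> L2 (mul_indic A g).
Proof.
move=> mA fA mg gC.
apply: (@L2_le _ lebT R leb (mul_indic A g) (fun x : R => C * \1_A x)).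
- exact: cmeasM (cmeas_indic mA) mg.
- by apply: integrable_mulrl; exact: integrable_indic_leb.
- move=> x; rewrite /mul_indic nsq_indicM indicE.
  have [/set_mem Ax|_] := boolP (x \in A); last by rewrite mul0r mulr0.
  by rewrite mul1r mulr1 gC.
Qed.

Lemma normsq_le A g (C : R) : lebesgue_measurable A -> (leb A < +oo)%E ->
  0 <= C -> L2 g -> {ae leb, forall x, nsq (g x) <= C * \1_A x} ->
  normsq g <= C * vol A.
Proof.
move=> mA fA C0 Lg gC; rewrite -lee_fin normsqE// EFinM -leb_fin_vol//.
have <- : (\int[leb]_(x in setT) (C * \1_A x)%:E = C%:E * leb A)%E.
  have mI := measurable_int leb (integrable_indic_leb mA fA).
  have I0 (x : lebT) : setT x -> (0 <= (EFin \o (\1_A : lebT -> R)) x)%E.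
    by move=> _; rewrite lee_fin indicE ler0n.
  have C0e : (0 <= C%:E)%E by rewrite lee_fin.
  apply: etrans (ge0_integralZl leb measurableT mI I0 C0e) _.
  by rewrite integral_indic// setIT.
apply: ae_ge0_le_integral.
- exact: measurableT.
- by move=> x _; rewrite lee_fin nsq_ge0.
- exact: (measurable_int leb (L2_int Lg)).
- by move=> x _; rewrite lee_fin mulr_ge0// indicE ler0n.
- exact: (measurable_int leb (integrable_mulrl C (integrable_indic_leb mA fA))).
- by apply: filterS gC => x + _; rewrite lee_fin.
Qed.

(** The conjugation in [inner] turns this phase into that of the Fourier kernel. *)
Definition wave A (xi : R) : R -> R[i] := mul_indic A (fun x => expi (2 * pi * x * xi)).

Lemma cmeas_wave xi : @cmeas _ lebT R (fun x : R => expi (2 * pi * x * xi)).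
Proof.
have -> : (fun x : R => expi (2 * pi * x * xi)) = (fun x => expi (2 * pi * xi * x + 0)).
  by apply/funext => x; congr expi; ring.
exact: cmeas_expi.
Qed.

Lemma L2_wave A xi : lebesgue_measurable A -> (leb A < +oo)%E -> L2 (wave A xi).
Proof.
move=> mA fA; apply: (L2_indicM mA fA (cmeas_wave xi) (C := 1)) => x _.
by rewrite nsq_expi.
Qed.

Lemma fourierE A f xi : fourier (mul_indic A f) xi = inner f (wave A xi).
Proof.
rewrite /fourier /inner; congr cintegral; apply/funext => x.
by rewrite /wave /mul_indic expiN; apply: complex_ext; rewrite !reimE /=; ring.
Qed.

Lemma KopE A B c f :
  Kop A B c f = mul_indic (dilate c B) (fun xi => inner f (wave A xi)).
Proof. by apply/funext => xi; rewrite /Kop /mul_indic -fourierE. Qed.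

Lemma nsq_innerC f g : L2 f -> L2 g -> nsq (inner f g) = nsq (inner g f).
Proof. by move=> Lf Lg; rewrite (innerC Lf Lg) nsq_conj. Qed.

Lemma innerBr f g h : L2 f -> L2 g -> L2 h ->
  inner f g - inner f h = conjc (inner (fun x => -1 * h x + g x) f).
Proof.
move=> Lf Lg Lh; rewrite inner_lin// (innerC Lf Lg) (innerC Lf Lh).
by apply: complex_ext; rewrite !reimE /=; ring.
Qed.

(** * Approximation of [Kop] by kernels of rank N *)

Section Operator.
Variables (A B : set R) (c : R).
Hypothesis (mA : lebesgue_measurable A) (mB : lebesgue_measurable B).
Hypothesis (bA : bounded_set A) (bB : bounded_set B).
Hypothesis (fA : (leb A < +oo)%E) (fB : (leb B < +oo)%E).
Hypothesis c0 : 0 < c.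

Let mcB : lebesgue_measurable (dilate c B).
Proof. exact: lebesgue_measurable_dilate. Qed.

Let fcB : (leb (dilate c B) < +oo)%E.
Proof. by rewrite leb_dilate// (leb_fin_vol fB) -EFinM ltry. Qed.

Let vol_cB : vol (dilate c B) = c * vol B.
Proof. by rewrite /vol leb_dilate// (leb_fin_vol fB) -EFinM. Qed.

Lemma normsq_wave xi : normsq (wave A xi) <= vol A.
Proof.
rewrite -[leRHS]mul1r; apply: (normsq_le mA fA ler01 (L2_wave xi mA fA)).
by apply: nearW => x; rewrite /wave nsq_indicM nsq_expi mulr1 mul1r.
Qed.

(** On A, where |x| <= M, two waves differ by at most 2 pi M |xi - eta|; Cauchy-Schwarz then gives
    the constant. The resulting continuity in xi yields the measurability of [Kop A B c f]. *)
Lemma wave_lipschitz f : L2 f -> exists C, forall xi eta,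
  nsq (inner f (wave A xi) - inner f (wave A eta)) <= C * (xi - eta) ^+ 2.
Proof.
move=> Lf; have [M AM] := bounded_set_norm_le bA.
exists ((2 * pi * M) ^+ 2 * vol A * normsq f) => xi eta.
have Lx := L2_wave xi mA fA; have Le := L2_wave eta mA fA.
rewrite innerBr// nsq_conj.
have Ld := L2_lin (-1) Le Lx.
apply: le_trans (inner_CS Ld Lf) _.
rewrite mulrAC ler_wpM2r ?normsq_ge0// mulrAC.
apply: (normsq_le mA fA _ Ld); first by rewrite mulr_ge0 ?sqr_ge0.
apply: nearW => x.
have -> : -1 * wave A eta x + wave A xi x =
    (\1_A x)%:C * (expi (2 * pi * x * xi) - expi (2 * pi * x * eta)).
  by rewrite /wave /mul_indic; ring.
rewrite nsq_indicM indicE; have [/set_mem Ax|_] := boolP (x \in A); last first.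
  by rewrite mul0r mulr0.
rewrite mul1r mulr1; apply: le_trans (nsq_expiB _ _) _.
rewrite -mulrBr !exprMn ler_wpM2r ?sqr_ge0// ler_wpM2l//.
  by rewrite -exprMn sqr_ge0.
rewrite -real_normK ?num_real// lerXn2r ?nnegrE//; last exact: AM.
exact: le_trans (AM _ Ax).
Qed.

Lemma L2_Kop f : L2 f -> L2 (Kop A B c f).
Proof.
move=> Lf; rewrite KopE.
have [C HC] := wave_lipschitz Lf.
have mI : @cmeas _ lebT R (fun xi => inner f (wave A xi)).
  split; apply: continuous_measurable_leb;
    apply: (@continuous_sq_lipschitz C) => x y; apply: le_trans (HC x y);
    by rewrite /nsq !reimE ?lerDl ?lerDr sqr_ge0.
apply: (L2_indicM mcB fcB mI (C := normsq f * vol A)) => xi _.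
apply: le_trans (inner_CS Lf (L2_wave xi mA fA)) _.
by rewrite ler_wpM2l ?normsq_ge0// normsq_wave.
Qed.

(** The x-dependent factor of the k-th Taylor term of the kernel; the first N of these are the
    functions to which f is made orthogonal. *)
Definition probe (x0 xi0 : R) (k : nat) : R -> R[i] :=
  mul_indic A (fun x => ((x - x0) ^+ k)%:C * expi (2 * pi * x * xi0)).

Lemma L2_probe x0 xi0 k : L2 (probe x0 xi0 k).
Proof.
have [M AM] := bounded_set_norm_le bA.
have mk : @cmeas _ lebT R (fun x => ((x - x0) ^+ k)%:C * expi (2 * pi * x * xi0)).
  apply: cmeasM (cmeas_wave xi0); apply: cmeas_real; apply: measurable_funX.
  apply: continuous_measurable_leb; apply: (@continuous_sq_lipschitz 1) => x y.
  by rewrite mul1r opprB addrA subrK.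
apply: (L2_indicM mA fA mk (C := ((M + `|x0|) ^+ k) ^+ 2)) => x Ax.
rewrite nsqM nsqC nsq_expi mulr1 -real_normK ?num_real// lerXn2r ?nnegrE//.
  by rewrite exprn_ge0// addr_ge0// (le_trans _ (AM _ Ax)).
rewrite normrX lerXn2r ?nnegrE// ?addr_ge0// ?(le_trans _ (AM _ Ax))//.
by rewrite (le_trans (ler_normB _ _))// lerD2r AM.
Qed.

(** The factor of the k-th Taylor term that depends on xi only. *)
Definition probe_coef (x0 xi0 xi : R) (k : nat) : R[i] :=
  expi (2 * pi * x0 * (xi - xi0)) * ((2 * pi * (xi - xi0)) ^+ k / k`!%:R)%:C * 'i ^+ k.

(** From x xi = x0 (xi - xi0) + x xi0 + (x - x0)(xi - xi0): the first two phases factor out and only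
    the third is expanded. *)
Lemma wave_split N x0 xi0 xi x :
  -1 * (\sum_(k < N) probe_coef x0 xi0 xi k * probe x0 xi0 k x) + wave A xi x =
  (\1_A x)%:C * (expi (2 * pi * x0 * (xi - xi0)) * expi (2 * pi * x * xi0) *
    expi_rem N (2 * pi * (x - x0) * (xi - xi0))).
Proof.
rewrite /wave /mul_indic.
have -> : 2 * pi * x * xi = 2 * pi * x0 * (xi - xi0) + 2 * pi * x * xi0 +
   2 * pi * (x - x0) * (xi - xi0) by ring.
suff -> : \sum_(k < N) probe_coef x0 xi0 xi k * probe x0 xi0 k x =
    (\1_A x)%:C * (expi (2 * pi * x0 * (xi - xi0)) * expi (2 * pi * x * xi0) *
    expi_taylor N (2 * pi * (x - x0) * (xi - xi0))).
  by rewrite !expiD /expi_rem; ring.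
rewrite /expi_taylor !mulr_sumr; apply: eq_bigr => k _.
rewrite /probe_coef /probe /mul_indic.
have -> : ((2 * pi * (x - x0) * (xi - xi0)) ^+ k / k`!%:R)%:C =
    ((2 * pi * (xi - xi0)) ^+ k / k`!%:R)%:C * ((x - x0) ^+ k)%:C :> R[i].
  by rewrite -rmorphM /=; congr (_%:C); rewrite !exprMn; ring.
by ring.
Qed.

(** As f is orthogonal to the probes, only the remainder part of the wave contributes; its phase is
    at most 2 pi ([diam_ess A] / 2) r on almost all of A, and Cauchy-Schwarz concludes. *)
Lemma inner_wave_le N x0 xi0 xi r f : L2 f ->
  (forall k : 'I_N, inner f (probe x0 xi0 k) = 0) ->
  {ae leb, forall x, A x -> `|x - x0| <= diam_ess A / 2} -> `|xi - xi0| <= r ->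
  nsq (inner f (wave A xi)) <=
    ((pi * diam_ess A * r) ^+ N / N`!%:R) ^+ 2 * vol A * normsq f.
Proof.
move=> Lf fprobe Ax0 xir.
have Lp (k : 'I_N) : L2 (probe x0 xi0 k) by exact: L2_probe.
have Lw := L2_wave xi mA fA.
pose s := fun x => \sum_(k < N) probe_coef x0 xi0 xi k * probe x0 xi0 k x.
have Ls : L2 s by exact: L2_sum.
have Lr := L2_lin (-1) Ls Lw.
have sf0 : inner s f = 0.
  rewrite /s inner_sum// big1// => k _.
  by rewrite (innerC Lf (Lp k)) fprobe conjc0 mulr0.
have -> : nsq (inner f (wave A xi)) = nsq (inner (fun x => -1 * s x + wave A xi x) f).
  by rewrite inner_lin// sf0 mulr0 add0r nsq_innerC.
apply: le_trans (inner_CS Lr Lf) _.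
rewrite ler_wpM2r ?normsq_ge0//.
apply: (normsq_le mA fA (sqr_ge0 _) Lr).
apply: filterS Ax0 => x Ax0; rewrite wave_split nsq_indicM indicE.
have [/set_mem Ax|_] := boolP (x \in A); last by rewrite mul0r mulr0.
rewrite mul1r mulr1 !nsqM !nsq_expi !mul1r.
apply: le_trans (nsq_expi_rem _ _) _.
rewrite lerXn2r ?nnegrE ?divr_ge0 ?exprn_ge0//.
  by rewrite !mulr_ge0 ?pi_ge0 ?diam_ess_ge0// (le_trans _ xir).
rewrite ler_wpM2r ?invr_ge0// lerXn2r ?nnegrE//.
  by rewrite !mulr_ge0 ?pi_ge0 ?diam_ess_ge0// (le_trans _ xir).
rewrite !normrM (ger0_norm (pi_ge0 R)) (ger0_norm (ler0n R 2)).
have -> : pi * diam_ess A * r = 2 * pi * (diam_ess A / 2) * r by field.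
rewrite ler_pM// ?mulr_ge0 ?pi_ge0//.
by rewrite ler_wpM2l ?mulr_ge0 ?pi_ge0// Ax0.
Qed.

Lemma ess_center_dilate : exists xi0,
  {ae leb, forall xi, dilate c B xi -> `|xi - xi0| <= c * diam_ess B / 2}.
Proof.
have [y0 [Z [mZ Z0 BZ]]] := ess_center mB bB.
exists (c * y0), (dilate c Z); split.
- exact: lebesgue_measurable_dilate.
- by rewrite leb_dilate// Z0 mule0.
move=> xi nxi; have cn0 : c != 0 by rewrite gt_eqF.
apply/(dilateE _ _ cn0); apply: BZ => By; apply: nxi => /(dilateE _ _ cn0) /By H.
have -> : xi - c * y0 = c * (c^-1 * xi - y0) by rewrite mulrBr mulVKf.
by rewrite normrM (gtr0_norm c0) -mulrA ler_pM2l.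
Qed.

(** The choice r = c [diam_ess B] / 2 turns pi [diam_ess A] r into zeta. Integrating the pointwise
    bound over cB, of measure c [vol B], completes the factor m. *)
Lemma normsq_Kop_le N (zeta := pi * c / 2 * diam_ess A * diam_ess B) :
  exists phi : 'I_N -> R -> R[i], (forall k, L2 (phi k)) /\
  forall f, L2 f -> (forall k, inner f (phi k) = 0) ->
    normsq (Kop A B c f) <=
      (Num.sqrt (c * vol A * vol B) * (zeta ^+ N / N`!%:R)) ^+ 2 * normsq f.
Proof.
have [x0 Ax0] := ess_center mA bA.
have [xi0 Bxi0] := ess_center_dilate.
exists (fun k => probe x0 xi0 k); split=> [k|f Lf fphi]; first exact: L2_probe.
pose b := (zeta ^+ N / N`!%:R) ^+ 2 * vol A * normsq f.
have b0 : 0 <= b := mulr_ge0 (mulr_ge0 (sqr_ge0 _) (vol_ge0 A)) (normsq_ge0 leb f).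
have -> : (Num.sqrt (c * vol A * vol B) * (zeta ^+ N / N`!%:R)) ^+ 2 * normsq f =
    b * vol (dilate c B).
  rewrite vol_cB exprMn sqr_sqrtr ?mulr_ge0 ?vol_ge0 ?(ltW c0)//.
  by rewrite /b; ring.
apply: (normsq_le mcB fcB b0 (L2_Kop Lf)).
apply: filterS Bxi0 => xi Bxi; rewrite KopE nsq_indicM indicE.
have [/set_mem Bx|_] := boolP (xi \in _); last by rewrite mul0r mulr0.
rewrite mul1r mulr1.
apply: le_trans (inner_wave_le Lf fphi Ax0 (Bxi Bx)) _.
have -> // : pi * diam_ess A * (c * diam_ess B / 2) = zeta by rewrite /zeta; field.
Qed.

End Operator.

End FourierBound.

(** * The factorial threshold and the Lambert function *)

Section Lambert.
Variable R : realType.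
Implicit Types m zeta eps rho x : R.

Lemma exp_coeff_small zeta e : 0 < e -> exists N, zeta ^+ N / N`!%:R <= e.
Proof.
move=> e0; have /cvgrPdist_le /(_ _ e0)[N _ /(_ N)] := cvg_exp_coeff zeta.
rewrite /= leqnn sub0r normrN => /(_ isT) H.
by exists N; apply: le_trans (ler_norm _) H.
Qed.

(** Terms of the exponential series tend to 0 and sqrt eps > 0, so the minimum exists and [N_fac] is
    not the default value. *)
Lemma N_facP m zeta eps : 0 < eps ->
  Num.sqrt m * (zeta ^+ N_fac m zeta eps / (N_fac m zeta eps)`!%:R) <= Num.sqrt eps /\
  forall k : nat, Num.sqrt m * (zeta ^+ k / k`!%:R) <= Num.sqrt eps ->
    (N_fac m zeta eps <= k)%N.
Proof.
move=> eps0.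
have : exists N : nat, Num.sqrt m * (zeta ^+ N / N`!%:R) <= Num.sqrt eps.
  have s0 : 0 < Num.sqrt eps by rewrite sqrtr_gt0.
  have := sqrtr_ge0 m; rewrite le_eqVlt => /predU1P[<-|m0].
    by exists 0%N; rewrite mul0r ltW.
  have [N HN] := exp_coeff_small zeta (divr_gt0 s0 m0).
  by exists N; rewrite mulrC -ler_pdivlMr.
move=> exN; apply: (@xgetPex _ 0%N [set N : nat |
    Num.sqrt m * (zeta ^+ N / N`!%:R) <= Num.sqrt eps /\
    forall k : nat, Num.sqrt m * (zeta ^+ k / k`!%:R) <= Num.sqrt eps -> (N <= k)%N]).
by case: (ex_minnP exN) => N HN Nmin; exists N.
Qed.

(** A root exists in [0, x] by the intermediate value theorem, as x <= x exp(x). The chosen root is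
    positive because its product with a positive exponential is x > 0. *)
Lemma lambertW0P x : 0 < x ->
  0 < lambertW0 x /\ lambertW0 x * expR (lambertW0 x) = x.
Proof.
move=> x0.
have [w w0 wx] : exists2 w, 0 <= w & w * expR w = x.
  have [||w] := @IVT R (fun w => w * expR w) 0 x x (ltW x0).
  - apply: continuous_subspaceT => w; apply: cvgM; first exact: cvg_id.
    exact: continuous_expR.
  - have xle : x <= x * expR x by rewrite ler_peMr ?(ltW x0)// -expR0 ler_expR ltW.
    have xe0 := le_trans (ltW x0) xle.
    by rewrite mul0r min_l// max_r// ltW.
  - by rewrite in_itv/= => /andP[? _] ?; exists w.
have [_ Wx] : -1 <= lambertW0 x /\ lambertW0 x * expR (lambertW0 x) = x.
  apply: (@xgetPex _ 0 [set w : R | -1 <= w /\ w * expR w = x]).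
  by exists w; split=> //; apply: le_trans w0.
by split=> //; rewrite -(pmulr_lgt0 _ (expR_gt0 (lambertW0 x))) Wx.
Qed.

(** N^N / N! is one term of the exponential series at N. *)
Lemma expn_le_fact N : (N%:R : R) ^+ N <= N`!%:R * expR 1 ^+ N.
Proof.
case: N => [|N]; first by rewrite !expr0 mulr1.
have := expR_ge1Dxn N (ler0n R N.+1).
move/(le_trans (_ : N.+1%:R ^+ N.+1 / N.+1`!%:R <= _)).
rewrite lerDr ler01 => /(_ isT).
by rewrite ler_pdivrMr ?ltr0n ?fact_gt0// mulrC -expRM_natl mulr1.
Qed.

Lemma N_fac_le_lambert m zeta eps
    (rho := 1 / 2 * ln (m / eps)) (t := rho / lambertW0 (rho / (expR 1 * zeta))) :
  0 < eps -> eps < m -> 0 < zeta ->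
  0 < rho /\ ((N_fac m zeta eps)%:Z <= Num.ceil t)%R.
Proof.
move=> eps0 epsm z0; have m0 := lt_trans eps0 epsm.
have r0 : 0 < rho by rewrite mulr_gt0// ln_gt0// ltr_pdivlMr// mul1r.
split=> //.
have x0 : 0 < rho / (expR 1 * zeta) by rewrite divr_gt0// mulr_gt0// expR_gt0.
have [w0 wx] := lambertW0P x0.
set w := lambertW0 _ in t w0 wx *.
have t0 : 0 < t by rewrite divr_gt0.
have [N NE] : exists N : nat, Num.ceil t = N%:Z.
  have : 0 <= Num.ceil t by rewrite ceil_ge0 (lt_trans _ t0)// ltrN10.
  by case: (Num.ceil t) => // N _; exists N.
have tN : t <= N%:R.
  by have := ceil_ge t; rewrite NE.
rewrite NE lez_nat; apply: (N_facP m zeta eps0).2.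
(* As rho is half of ln (m / eps), the goal reduces to zeta^N / N! <= exp(- rho). *)
have sm : Num.sqrt m = Num.sqrt eps * expR rho.
  rewrite -[expR rho]ger0_norm ?expR_ge0// -sqrtr_sqr -sqrtrM ?ltW//.
  congr Num.sqrt; rewrite expr2 -expRD.
  have -> : rho + rho = ln (m / eps) by rewrite /rho; lra.
  by rewrite lnK ?posrE ?divr_gt0// mulrC divfK// gt_eqF.
rewrite sm -mulrA ler_piMr ?sqrtr_ge0//.
(* The equation w exp(w) = rho / (e zeta) says e zeta = t exp(- w), and t <= N. *)
have E1 : expR 1 * zeta <= N%:R * expR (- w).
  apply: (@le_trans _ _ (t * expR (- w))); last by rewrite ler_wpM2r ?expR_ge0.
  rewrite expRN /t le_eqVlt; apply/orP; left; apply/eqP.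
  have : rho = w * expR w * (expR 1 * zeta).
    by rewrite wx divfK// gt_eqF// mulr_gt0 ?expR_gt0.
  move=> rE; rewrite rE; field.
  by rewrite !gt_eqF ?expR_gt0.
(* The N-th power of [E1], with N^N <= N! e^N and N w >= t w = rho. *)
have E2 : zeta ^+ N <= N`!%:R * expR (- rho).
  rewrite -(ler_pM2l (exprn_gt0 N (expR_gt0 (1 : R)))) -exprMn.
  apply: (@le_trans _ _ ((N%:R * expR (- w)) ^+ N)).
    by rewrite lerXn2r ?nnegrE// ?mulr_ge0 ?expR_ge0// ltW.
  rewrite exprMn mulrCA mulrA (mulrC (N`!%:R)).
  rewrite ler_pM ?exprn_ge0 ?expR_ge0//; first by rewrite mulrC; exact: expn_le_fact.
  by rewrite -expRM_natl ler_expR mulrN lerN2 -ler_pdivrMr.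
rewrite mulrA ler_pdivrMr ?ltr0n ?fact_gt0// mul1r.
rewrite -(mulr1 (N`!%:R)) -(mulrC (zeta ^+ N)).
by rewrite -ler_pdivlMr ?expR_gt0// mulr1 -expRN.
Qed.

End Lambert.

(** * Singular value, spectral count and Lambert bounds for the truncated Fourier operator *)

Theorem theorem4p2 (R : realType) (A B : set R) (c : R)
    (mA : lebesgue_measurable A) (mB : lebesgue_measurable B)
    (bA : bounded_set A) (bB : bounded_set B)
    (finA : (leb R A < +oo)%E) (finB : (leb R B < +oo)%E)
    (c_gt0 : 0 < c) :
  let K := Kop A B c in
  let S := Sop A B c in
  let m := c * vol A * vol B in
  let zeta := pi * c / 2 * diam_ess A * diam_ess B in
  (forall N : nat,
    (singular_value (leb R) K N.+1
      <= (Num.sqrt m * (zeta ^+ N / N`!%:R))%:E)%E) /\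
  (forall eps : R, 0 < eps -> eps < 1 / 2 ->
    [/\ (Lambda (leb R) eps S <= (N_fac m zeta eps)%:R%:E)%E,
        m <= eps -> Lambda (leb R) eps S = 0%E &
        eps < m ->
        let rho := 1 / 2 * ln (m / eps) in
        let h := c * diam_ess A * diam_ess B in
        let L := Num.ceil (rho / lambertW0 (rho / (expR 1 * zeta))) in
        [/\ 0 < rho,
            (Lambda (leb R) eps S <= L%:~R%:E)%E,
            L = Num.ceil (rho / lambertW0 (2 * rho / (expR 1 * pi * h))) &
            ((N_fac m zeta eps)%:Z <= L)%R]]).
Proof.
move=> K S m zeta.
have dA0 := diam_ess_ge0 bA; have dB0 := diam_ess_ge0 bB.
have zeta0 : 0 <= zeta by rewrite !mulr_ge0 ?invr_ge0 ?pi_ge0// ltW.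
pose bound N := Num.sqrt m * (zeta ^+ N / N`!%:R).
have bound0 N : 0 <= bound N.
  by rewrite mulr_ge0 ?sqrtr_ge0// divr_ge0// exprn_ge0.
have LK f : L2 (leb R) f -> L2 (leb R) (K f) by move=> Lf; exact: L2_Kop.
have LambdaN eps N : 0 < eps -> bound N <= Num.sqrt eps ->
    (Lambda (leb R) eps S <= N%:R%:E)%E.
  move=> eps0 Ne; have [phi [Lphi phiK]] := normsq_Kop_le mA mB bA bB finA finB c_gt0 N.
  apply: (Lambda_le Lphi LK phiK).
  rewrite -[leRHS](sqr_sqrtr (ltW eps0)) -/(bound N).
  by rewrite lerXn2r ?nnegrE ?sqrtr_ge0 ?(bound0 N).
split=> [N|eps eps0 _].
  have [phi [Lphi phiK]] := normsq_Kop_le mA mB bA bB finA finB c_gt0 N.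
  exact: (singular_value_le Lphi LK (bound0 N) phiK).
have LambdaF := LambdaN _ _ eps0 (N_facP m zeta eps0).1.
split=> // [meps|epsm rho h L].
  apply/eqP; rewrite eq_le; apply/andP; split.
    (* N = 0 suffices, because the bound is then sqrt m. *)
    apply: (LambdaN _ 0%N eps0).
    by rewrite /bound expr0 divr1 mulr1 ler_wsqrtr.
  (* The empty family shows that a rank is at least 0. *)
  apply: ereal_sup_ubound; exists 0%N => //.
  by exists (fun _ _ => 0); split=> [[]//|a _ []].
have m0 : 0 < m := lt_trans eps0 epsm.
(* m > 0 forces positive volumes, hence positive essential diameters; this makes the argument of
   [lambertW0] positive. *)
have zeta_gt0 : 0 < zeta.
  have volA : vol A <= diam_ess A.
    by rewrite -lee_fin -leb_fin_vol//; exact: leb_le_diam_ess.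
  have volB : vol B <= diam_ess B.
    by rewrite -lee_fin -leb_fin_vol//; exact: leb_le_diam_ess.
  have AB0 : 0 < vol A * vol B by move: m0; rewrite /m -mulrA pmulr_rgt0.
  rewrite /zeta -mulrA; apply: mulr_gt0; first by rewrite !mulr_gt0 ?invr_gt0 ?pi_gt0.
  by apply: lt_le_trans AB0 _; rewrite ler_pM ?vol_ge0.
have [rho0 FL] := N_fac_le_lambert eps0 epsm zeta_gt0.
split=> //.
  apply: le_trans LambdaF _; rewrite lee_fin.
  by rewrite -(ler_int R) in FL.
have zetaE : zeta = pi * h / 2 by rewrite /zeta /h; field.
have h0 : h != 0 by apply: contraTneq zeta_gt0 => h0; rewrite zetaE h0 mulr0 mul0r ltxx.
have lambert_arg (e p y r : R) : e != 0 -> p != 0 -> y != 0 ->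
    r / (e * (p * y / 2)) = 2 * r / (e * p * y).
  by move=> e0 p0 y0; field; rewrite e0 p0 y0.
by rewrite /L zetaE lambert_arg// lt0r_neq0 ?expR_gt0 ?pi_gt0.
Qed.
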